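(* Let $T>0$ and let $\hat G_1,\hat G_2:(0,T]\to\mathcal{M}_d(\mathbb{R})$ be measurable kernels for which there exists $\bar C>0$ such that $$\|\hat G_j(t)\|^2\le \bar C\,(1+\|G_j(t)\|^2),\qquad j\in\{1,2\},\ t\in(0,T].$$ Let $X$ and $\hat X$ be the solutions on $[0,T]$ of $$X_t=x_0+\int_0^t G_1(t-s)b(X_s)\,ds+\int_0^t G_2(t-s)\sigma(X_s)\,dW_s,$$ $$\hat X_t=x_0+\int_0^t \hat G_1(t-s)b(\hat X_s)\,ds+\int_0^t \hat G_2(t-s)\sigma(\hat X_s)\,dW_s.$$ Then there exists a constant $C>0$ (depending on $x_0$, $T$, $b$, $\sigma$, $G_1$, $G_2$ and $\bar C$) such that for all $t\in[0,T]$, $$\mathbb{E}[|\hat X_t-X_t|^2]\le C\int_0^t\Big(\|\hat G_1(s)-G_1(s)\|^2+\|\hat G_2(s)-G_2(s)\|^2\Big)ds .$$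
   Context: Fix $d\ge1$, a deterministic $x_0\in\mathbb{R}^d$ and a standard $d$-dimensional Brownian motion $W$ on a filtered probability space. $\mathcal{M}_d(\mathbb{R})$ is the space of real $d\times d$ matrices, $|\cdot|$ is the Euclidean norm on $\mathbb{R}^d$ and $\|\cdot\|$ the Frobenius norm on $\mathcal{M}_d(\mathbb{R})$; $\mathbb{R}_+=[0,\infty)$. The coefficients $b:\mathbb{R}^d\to\mathbb{R}^d$ and $\sigma:\mathbb{R}^d\to\mathcal{M}_d(\mathbb{R})$ are globally Lipschitz: there is $L>0$ with $|b(x)-b(y)|+\|\sigma(x)-\sigma(y)\|\le L|x-y|$ for all $x,y$. $\lambda$ is a (nonnegative) measure on $\mathbb{R}_+$ such that $\bar G(t):=\int_{\mathbb{R}_+}e^{-\rho t}\lambda(d\rho)<\infty$ for all $t>0$ and $\int_0^{S}\bar G(t)^2dt<\infty$ for all $S>0$. $M_1,M_2:\mathbb{R}_+\to\mathcal{M}_d(\mathbb{R})$ are bounded measurable functions and $G_j(t)=\int_{\mathbb{R}_+}e^{-\rho t}M_j(\rho)\lambda(d\rho)$ for $t>0$, $j\in\{1,2\}$. A solution of a stochastic Volterra equation is an adapted measurable process with $\sup_{t\le T}\mathbb{E}|X_t|^2<\infty$ satisfying the equation almost surely for each $t$; existence and uniqueness of strong solutions under these assumptions is known (X. Zhang). *)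

(* Defs.v *)
From mathcomp Require Import all_boot all_order all_algebra.
From mathcomp Require Import all_classical all_reals all_analysis.

Set Implicit Arguments.
Unset Strict Implicit.
Unset Printing Implicit Defensive.
Import Order.TTheory GRing.Theory Num.Theory.
Import numFieldNormedType.Exports.
Local Open Scope classical_set_scope.
Local Open Scope ring_scope.

(* The Frobenius norm on matrices; on column vectors it is the Euclidean
   norm.  (The library norm of matrices is the sup norm.) *)
Definition frob (R : realType) (m n : nat) (A : 'M[R]_(m, n)) : R :=
  Num.sqrt (\sum_(i < m) \sum_(j < n) A i j ^+ 2).

Definition mx_measurable (disp : measure_display) (T : measurableType disp)
    (R : realType) (m n : nat) (D : set T) (f : T -> 'M[R]_(m, n)) : Prop :=
  forall i j, measurable_fun D (fun x => f x i j).

Definition lipschitz_coeffs (R : realType) (d : nat)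
    (b : 'cV[R]_d -> 'cV[R]_d) (sigma : 'cV[R]_d -> 'M[R]_d) : Prop :=
  exists2 L : R, 0 < L & forall x y,
    frob (b x - b y) + frob (sigma x - sigma y) <= L * frob (x - y).

(* A measure on [0, +oo) is represented by a Borel measure on the whole real
   line, which is only ever integrated over [0, +oo). *)
Definition Gbar (R : realType) (lambda : {measure set R -> \bar R}) (t : R)
    : \bar R :=
  (\int[lambda]_(rho in `[0%R, +oo[) (expR (- (rho * t)))%:E)%E.

Definition admissible_measure (R : realType)
    (lambda : {measure set R -> \bar R}) : Prop :=
  (forall t : R, 0 < t -> (Gbar lambda t < +oo)%E) /\
  (forall S : R, 0 < S ->
    (\int[lebesgue_measure]_(t in `]0%R, S]) (Gbar lambda t ^+ 2) < +oo)%E).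

Definition bounded_measurable_mx (R : realType) (d : nat) (M : R -> 'M[R]_d)
    : Prop :=
  mx_measurable (`[0, +oo[ : set R) M /\
  exists K : R, forall rho : R, 0 <= rho -> frob (M rho) <= K.

Definition laplace_kernel (R : realType) (d : nat)
    (lambda : {measure set R -> \bar R}) (M : R -> 'M[R]_d) (t : R)
    : 'M[R]_d :=
  \matrix_(i, j)
    (\int[lambda]_(rho in `[0, +oo[) (expR (- (rho * t)) * M rho i j)).

Record is_filtration (disp : measure_display) (Omega : measurableType disp)
    (R : realType) (F : R -> set_system Omega) : Prop := IsFiltration {
  filtration_sigma : forall t : R, 0 <= t -> sigma_algebra setT (F t) ;
  filtration_sub : forall t : R, 0 <= t -> F t `<=` measurable ;
  filtration_mono : forall s t : R, 0 <= s -> s <= t -> F s `<=` F t }.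

(* Measurability of a random matrix with respect to a sub-sigma-algebra G. *)
Definition mx_measurable_wrt (Omega : Type) (R : realType) (m n : nat)
    (G : set_system Omega) (Y : Omega -> 'M[R]_(m, n)) : Prop :=
  forall i j (B : set R), measurable B -> G ((fun w => Y w i j) @^-1` B).

Definition increment_in (Omega : Type) (R : realType) (d : nat)
    (W : R -> Omega -> 'cV[R]_d) (s t : R) (B : 'I_d -> set R) : set Omega :=
  [set w | forall i, B i ((W t w - W s w) i 0)].

(* Standard d-dimensional Brownian motion relative to the filtration F.
   The second argument of normal_prob is the standard deviation. *)
Record is_brownian (disp : measure_display) (Omega : measurableType disp)
    (R : realType) (d : nat) (P : probability Omega R)
    (F : R -> set_system Omega) (W : R -> Omega -> 'cV[R]_d) : Prop :=
  IsBrownian {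
  brownian_adapted : forall t : R, 0 <= t -> mx_measurable_wrt (F t) (W t) ;
  brownian_start : {ae P, forall w, W 0 w = 0} ;
  brownian_continuous : {ae P, forall w, forall i : 'I_d,
    {within `[0, +oo[, continuous (fun t : R => W t w i 0)}} ;
  brownian_independent : forall s t : R, 0 <= s -> s < t ->
    forall A, F s A ->
    forall B : 'I_d -> set R, (forall i, measurable (B i)) ->
    (P (A `&` increment_in W s t B) =
     P A * P (increment_in W s t B))%E ;
  brownian_normal : forall s t : R, 0 <= s -> s < t ->
    forall B : 'I_d -> set R, (forall i, measurable (B i)) ->
    (P (increment_in W s t B) =
     \prod_(i < d) normal_prob 0%R (Num.sqrt (t - s)) (B i))%E }.

(* A simple process  s |-> \sum_k xi_k 1_(u_k, v_k](s).  The intervals may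
   overlap; this gives the same class as using the intervals of a partition,
   the linear span of the processes xi 1_(u, v]. *)
Record simple_process (Omega : Type) (R : realType) (m d : nat) :=
  SimpleProcess {
  sp_size : nat ;
  sp_left : 'I_sp_size -> R ;
  sp_right : 'I_sp_size -> R ;
  sp_coef : 'I_sp_size -> Omega -> 'M[R]_(m, d) }.

Definition simple_val (Omega : Type) (R : realType) (m d : nat)
    (S : simple_process Omega R m d) (s : R) (w : Omega) : 'M[R]_(m, d) :=
  \sum_(k < sp_size S)
    \1_(`]sp_left k, sp_right k]%classic) s *: sp_coef k w.

Definition simple_integral (Omega : Type) (R : realType) (m d : nat)
    (W : R -> Omega -> 'cV[R]_d) (S : simple_process Omega R m d) (w : Omega)
    : 'cV[R]_m :=
  \sum_(k < sp_size S)
    sp_coef k w *m (W (sp_right k) w - W (sp_left k) w).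

Definition is_simple (Omega : Type) (R : realType) (m d : nat)
    (F : R -> set_system Omega) (t : R) (S : simple_process Omega R m d)
    : Prop :=
  forall k : 'I_(sp_size S),
    [/\ 0 <= sp_left k, sp_left k <= sp_right k, sp_right k <= t,
        mx_measurable_wrt (F (sp_left k)) (sp_coef k)
      & exists K : R, forall w, frob (sp_coef k w) <= K].

(* Adapted measurable processes on [0, t) with E \int_0^t |H_s|^2 ds < oo. *)
Definition ito_integrand (disp : measure_display) (Omega : measurableType disp)
    (R : realType) (m d : nat) (P : probability Omega R)
    (F : R -> set_system Omega) (t : R) (H : R -> Omega -> 'M[R]_(m, d))
    : Prop :=
  [/\ mx_measurable ((`[0, t[ : set R) `*` setT) (fun p : R * Omega => H p.1 p.2),
      forall s : R, 0 <= s < t -> mx_measurable_wrt (F s) (H s)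
    & (\int[P]_w \int[lebesgue_measure]_(s in `[0%R, t[)
        (frob (H s w) ^+ 2)%:E < +oo)%E].

(* I is (a version of) the Ito integral \int_0^t H_s dW_s: the integrals of
   simple processes approximating H in L^2([0, t) x Omega) tend to I in
   L^2(Omega). *)
Definition is_ito_integral (disp : measure_display)
    (Omega : measurableType disp) (R : realType) (m d : nat)
    (P : probability Omega R) (F : R -> set_system Omega)
    (W : R -> Omega -> 'cV[R]_d) (t : R) (H : R -> Omega -> 'M[R]_(m, d))
    (I : Omega -> 'cV[R]_m) : Prop :=
  [/\ ito_integrand P F t H,
      mx_measurable setT I
    & exists S : nat -> simple_process Omega R m d,
      [/\ forall n, is_simple F t (S n),
          (\int[P]_w \int[lebesgue_measure]_(s in `[0%R, t[)
             (frob (H s w - simple_val (S n) s w) ^+ 2)%:E)%E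
             @[n --> \oo] --> 0%E
        & ('E_P[fun w => (frob (I w - simple_integral W (S n) w) ^+ 2)%R])%E
             @[n --> \oo] --> 0%E]].

(* X solves  X_t = x0 + \int_0^t K1(t - s) b(X_s) ds
                      + \int_0^t K2(t - s) sigma(X_s) dW_s  on [0, T].
   The kernels are only evaluated on (0, T], as s ranges over [0, t). *)
Record is_volterra_solution (disp : measure_display)
    (Omega : measurableType disp) (R : realType) (d : nat)
    (P : probability Omega R) (F : R -> set_system Omega)
    (W : R -> Omega -> 'cV[R]_d) (T : R) (x0 : 'cV[R]_d)
    (b : 'cV[R]_d -> 'cV[R]_d) (sigma : 'cV[R]_d -> 'M[R]_d)
    (K1 K2 : R -> 'M[R]_d) (X : R -> Omega -> 'cV[R]_d) : Prop :=
  IsVolterraSolution {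
  solution_measurable :
    mx_measurable ((`[0, T] : set R) `*` setT) (fun p : R * Omega => X p.1 p.2) ;
  solution_adapted :
    forall t : R, 0 <= t <= T -> mx_measurable_wrt (F t) (X t) ;
  solution_moment :
    (ereal_sup [set 'E_P[fun w => (frob (X t w) ^+ 2)%R] | t in `[0%R, T]]
      < +oo)%E ;
  solution_equation : forall t : R, 0 <= t <= T ->
    exists2 I : Omega -> 'cV[R]_d,
      is_ito_integral P F W t (fun s w => K2 (t - s) *m sigma (X s w)) I &
      {ae P, forall w,
        X t w = x0
          + (\col_i \int[lebesgue_measure]_(s in `[0, t[)
               ((K1 (t - s) *m b (X s w)) i 0))
          + I w} }.

(* Main.v *)
From HB Require Import structures.
Require Import Defs.
From mathcomp Require Import all_boot all_order all_algebra.
From mathcomp Require Import all_classical all_reals all_analysis.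
From mathcomp Require Import measurable_realfun ring lra.
Import Order.TTheory GRing.Theory Num.Theory.
Import numFieldNormedType.Exports.
Local Open Scope classical_set_scope.
Local Open Scope ring_scope.

Set Implicit Arguments.
Unset Strict Implicit.
Unset Printing Implicit Defensive.

(** Let X and X' solve the equation with the kernels K1, K2 and K1', K2'.  The
    difference X'_t - X_t is a drift integral plus an Ito integral, whose
    integrands have the form, with c = b or c = sigma,

      K'(t - s) (c(X'_s) - c(X_s)) + (K'(t - s) - K(t - s)) c(X_s).

    Let f(t) = E |X'_t - X_t| ^ 2.  The Cauchy-Schwarz inequality for the drift
    and the Ito isometry for the stochastic integral [volterra_difference_le],
    the Lipschitz condition for the first term and linear growth for the second
    one [coefficient_difference_le] give

      f(t) <= C (1 + M) a(t) + C (k * f)(t),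

    where a(t) is the integral over (0, t] of |K1' - K1| ^ 2 + |K2' - K2| ^ 2,
    M bounds the second moments of X, and the integrable function k dominates
    |K1'| ^ 2 and |K2'| ^ 2.  The function a is nondecreasing; weighting f by
    e^(- beta t), with beta so large that the convolution becomes a contraction,
    removes the last term [convolution_gronwall].  This is [volterra_stability].

    The constant must depend neither on the probability space nor on the
    solutions, whereas the moment bound contained in the notion of solution
    does.  So [volterra_stability] is used twice.  First it compares X with the
    constant process x0, which solves the equation with zero kernels: this
    bounds the moments of X uniformly.  Then it compares hX with X.  Both times
    k = (1 + Cbar) (1 + |G1| ^ 2 + |G2| ^ 2), which is integrable on (0, T]
    since |G_j| is at most a multiple of the integral of e^(- rho t) d lambda,
    which is square integrable [laplace_kernel_sqr_lty].

    Ito integrals are L^2 limits of integrals of simple processes, so their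
    isometry is derived from the one for simple processes [ito_isometry_le].
    The latter rests on the covariances of Brownian increments with coefficients
    known at the left end points [covariance_bincr], which follow from the
    independence of the increments and from two Gaussian moments.  The isometry
    is only claimed as an inequality up to a factor: by Cauchy-Schwarz the
    coordinates of W are treated one at a time, and the second moment of the
    standard normal law is kept as a number. *)

(** * Squared Frobenius norms *)

(** The square of the Frobenius norm: a polynomial in the entries, hence
    measurable and additive over entries, without any square root. *)
Definition nsq (R : realType) (m n : nat) (A : 'M[R]_(m, n)) : R :=
  \sum_(i < m) \sum_(j < n) A i j ^+ 2.

Section nsq_theory.
Context {R : realType}.

Lemma nsq_ge0 m n (A : 'M[R]_(m, n)) : 0 <= nsq A.
Proof. by do 2 (apply: sumr_ge0 => ? _); exact: sqr_ge0. Qed.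

Lemma frob_sqr m n (A : 'M[R]_(m, n)) : frob A ^+ 2 = nsq A.
Proof. by rewrite /frob sqr_sqrtr// nsq_ge0. Qed.

Lemma frobE m n (A : 'M[R]_(m, n)) : frob A = Num.sqrt (nsq A).
Proof. by []. Qed.

Lemma frob_ge0 m n (A : 'M[R]_(m, n)) : 0 <= frob A.
Proof. exact: sqrtr_ge0. Qed.

Lemma nsq0 m n : nsq (0 : 'M[R]_(m, n)) = 0.
Proof. by rewrite /nsq big1// => i _; rewrite big1// => j _; rewrite mxE expr0n. Qed.

Lemma nsqN m n (A : 'M[R]_(m, n)) : nsq (- A) = nsq A.
Proof. by apply: eq_bigr => i _; apply: eq_bigr => j _; rewrite mxE sqrrN. Qed.

Lemma nsqD_le m n (A B : 'M[R]_(m, n)) : nsq (A + B) <= 2 * nsq A + 2 * nsq B.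
Proof.
rewrite /nsq !mulr_sumr -big_split; apply: ler_sum => i _ /=.
rewrite !mulr_sumr -big_split; apply: ler_sum => j _ /=; rewrite mxE.
by have := sqr_ge0 (A i j - B i j); nra.
Qed.

Lemma nsqB_le m n (A B : 'M[R]_(m, n)) : nsq (A - B) <= 2 * nsq A + 2 * nsq B.
Proof. by rewrite (le_trans (nsqD_le _ _))// nsqN. Qed.

Lemma nsqBC m n (A B : 'M[R]_(m, n)) : nsq (A - B) = nsq (B - A).
Proof. by rewrite -nsqN opprB. Qed.

Lemma nsq_entry_le m n (A : 'M[R]_(m, n)) i j : A i j ^+ 2 <= nsq A.
Proof.
rewrite /nsq (bigD1 i)//= (bigD1 j)//= -addrA lerDl addr_ge0//.
  by apply: sumr_ge0 => ? _; exact: sqr_ge0.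
by do 2 (apply: sumr_ge0 => ? _); exact: sqr_ge0.
Qed.

Lemma frob_entry_le m n (A : 'M[R]_(m, n)) i j : `|A i j| <= frob A.
Proof. by rewrite -sqrtr_sqr ler_sqrt ?nsq_ge0// nsq_entry_le. Qed.

(** Lagrange's identity: the defect is half the sum over i and j of
    (f i * g j - f j * g i) ^ 2. *)
Lemma cauchy_schwarz_sum (I : finType) (f g : I -> R) :
  (\sum_i f i * g i) ^+ 2 <= (\sum_i f i ^+ 2) * (\sum_i g i ^+ 2).
Proof.
have h : 0 <= \sum_i \sum_j (f i * g j - f j * g i) ^+ 2.
  by do 2 (apply: sumr_ge0 => ? _); exact: sqr_ge0.
have E : \sum_i \sum_j (f i * g j - f j * g i) ^+ 2 =
    2 * ((\sum_i f i ^+ 2) * (\sum_i g i ^+ 2) - (\sum_i f i * g i) ^+ 2).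
  have -> : \sum_i \sum_j (f i * g j - f j * g i) ^+ 2 =
     \sum_i (f i ^+ 2 * (\sum_j g j ^+ 2) - 2 * (f i * g i) * (\sum_j f j * g j)
         + g i ^+ 2 * (\sum_j f j ^+ 2)).
    apply: eq_bigr => i _; rewrite !mulr_sumr -sumrB -big_split/=.
    by apply: eq_bigr => j _; ring.
  rewrite big_split/= sumrB -!mulr_suml -mulr_sumr; ring.
by move: h; rewrite E pmulr_rge0// subr_ge0.
Qed.

Lemma sum_sqr_le (I : finType) (f : I -> R) :
  (\sum_i f i) ^+ 2 <= #|I|%:R * \sum_i f i ^+ 2.
Proof.
have := cauchy_schwarz_sum f (fun=> 1).
under eq_bigr do rewrite mulr1.
under [X in _ <= _ * X]eq_bigr do rewrite expr1n.
by rewrite sumr_const mulrC.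
Qed.

Lemma nsqM_le m n p (A : 'M[R]_(m, n)) (B : 'M[R]_(n, p)) :
  nsq (A *m B) <= nsq A * nsq B.
Proof.
rewrite /nsq mulr_suml; apply: ler_sum => i _.
rewrite [X in _ * X]exchange_big/= mulr_sumr; apply: ler_sum => j _.
by rewrite mxE; exact: cauchy_schwarz_sum.
Qed.

(** The form in which the Lipschitz hypothesis is used: one constant for the
    two coefficients, for their increments and for their growth, the latter by
    comparison with the value at 0. *)
Lemma lipschitz_nsq d (b : 'cV[R]_d -> 'cV[R]_d) (sigma : 'cV[R]_d -> 'M[R]_d) :
  lipschitz_coeffs b sigma ->
  exists2 K : R, 0 < K &
    [/\ forall x y, nsq (b x - b y) <= K * nsq (x - y),
        forall x y, nsq (sigma x - sigma y) <= K * nsq (x - y),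
        forall x, nsq (b x) <= K * (1 + nsq x) &
        forall x, nsq (sigma x) <= K * (1 + nsq x)].
Proof.
move=> [L L0 bs].
have Lb x y : nsq (b x - b y) <= L ^+ 2 * nsq (x - y).
  rewrite -!frob_sqr -exprMn lerXn2r ?nnegrE ?frob_ge0// ?mulr_ge0 ?frob_ge0 ?(ltW L0)//.
  by apply: le_trans (bs x y); rewrite lerDl frob_ge0.
have Ls x y : nsq (sigma x - sigma y) <= L ^+ 2 * nsq (x - y).
  rewrite -!frob_sqr -exprMn lerXn2r ?nnegrE ?frob_ge0// ?mulr_ge0 ?frob_ge0 ?(ltW L0)//.
  by apply: le_trans (bs x y); rewrite lerDr frob_ge0.
have L2 : 0 < L ^+ 2 by rewrite exprn_gt0.
pose K := 2 * L ^+ 2 + 2 * nsq (b 0) + 2 * nsq (sigma 0).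
have b0 := nsq_ge0 (b 0); have s0 := nsq_ge0 (sigma 0).
have K0 : 0 < K by rewrite /K; nra.
exists K => //; split=> [x y|x y|x|x].
- by rewrite (le_trans (Lb x y))// ler_wpM2r ?nsq_ge0// /K; nra.
- by rewrite (le_trans (Ls x y))// ler_wpM2r ?nsq_ge0// /K; nra.
- rewrite -[b x](subrK (b 0)) (le_trans (nsqD_le _ _))//.
  have := Lb x 0; rewrite subr0 /K; have := nsq_ge0 x; nra.
- rewrite -[sigma x](subrK (sigma 0)) (le_trans (nsqD_le _ _))//.
  have := Ls x 0; rewrite subr0 /K; have := nsq_ge0 x; nra.
Qed.

End nsq_theory.

(** * Measurability of matrix-valued maps *)

Section mx_measurability.
Context {R : realType} {disp : measure_display} {T : measurableType disp}.
Implicit Type D : set T.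

Lemma mx_measurableD m n D (f g : T -> 'M[R]_(m, n)) :
  mx_measurable D f -> mx_measurable D g ->
  mx_measurable D (fun x => f x + g x).
Proof.
move=> mf mg i j; under eq_fun do rewrite mxE.
by apply: measurable_funD; [exact: mf|exact: mg].
Qed.

Lemma mx_measurableN m n D (f : T -> 'M[R]_(m, n)) :
  mx_measurable D f -> mx_measurable D (fun x => - f x).
Proof.
move=> mf i j; under eq_fun do rewrite mxE.
by apply: measurable_funN; exact: mf.
Qed.

Lemma mx_measurableB m n D (f g : T -> 'M[R]_(m, n)) :
  mx_measurable D f -> mx_measurable D g ->
  mx_measurable D (fun x => f x - g x).
Proof. by move=> mf mg; apply: mx_measurableD => //; exact: mx_measurableN. Qed.

Lemma mx_measurableM m n p D (f : T -> 'M[R]_(m, n)) (g : T -> 'M[R]_(n, p)) :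
  mx_measurable D f -> mx_measurable D g ->
  mx_measurable D (fun x => f x *m g x).
Proof.
move=> mf mg i j; under eq_fun do rewrite mxE.
apply: measurable_sum => k; apply: measurable_funM; [exact: mf|exact: mg].
Qed.

Lemma mx_measurable_sum m n D (I : Type) (r : seq I) (f : I -> T -> 'M[R]_(m, n)) :
  (forall k, mx_measurable D (f k)) ->
  mx_measurable D (fun x => \sum_(k <- r) f k x).
Proof.
move=> mf i j; under eq_fun do rewrite summxE.
by apply: measurable_sum => k; exact: mf.
Qed.

Lemma mx_measurable_cst m n D (A : 'M[R]_(m, n)) : mx_measurable D (fun=> A).
Proof. by move=> i j; exact: measurable_cst. Qed.

Lemma measurable_nsq m n D (f : T -> 'M[R]_(m, n)) :
  mx_measurable D f -> measurable_fun D (fun x => nsq (f x)).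
Proof.
move=> mf; apply: measurable_sum => i; apply: measurable_sum => j.
by apply: measurable_funX; exact: mf.
Qed.

Lemma measurable_frob m n D (f : T -> 'M[R]_(m, n)) :
  mx_measurable D f -> measurable_fun D (fun x => frob (f x)).
Proof.
move=> mf; apply: (@measurableT_comp _ _ _ _ _ _ (@Num.sqrt R)).
  by apply: continuous_measurable_fun; exact: sqrt_continuous.
exact: measurable_nsq.
Qed.

Lemma rat_cvec_dense d (x : 'cV[R]_d) (e : R) : 0 < e ->
  exists q : 'cV[rat]_d, frob (x - map_mx ratr q) < e.
Proof.
move=> e0.
pose eta := e / (d.+1)%:R.
have eta0 : 0 < eta by rewrite divr_gt0.
have h (i : 'I_d) : exists q : rat, `|x i 0 - ratr q| < eta.
  have /rat_in_itvoo[q] : x i 0 - eta < x i 0 + eta by lra.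
  rewrite in_itv/= => /andP[h1 h2]; exists q.
  by rewrite ltr_norml; lra.
have [q hq] := choice h.
exists (\col_i q i).
have : nsq (x - map_mx ratr (\col_i q i)) <= d%:R * eta ^+ 2.
  rewrite /nsq; under eq_bigr do rewrite big_ord1.
  have -> : d%:R * eta ^+ 2 = \sum_(i < d) eta ^+ 2.
    by rewrite sumr_const card_ord mulr_natl.
  apply: ler_sum => i _; rewrite !mxE -[leLHS]real_normK ?num_real// lerXn2r ?nnegrE//.
    exact: ltW.
  exact: ltW.
rewrite -ltr_sqr ?nnegrE ?frob_ge0//; last exact: ltW.
rewrite frob_sqr => /le_lt_trans; apply.
rewrite /eta expr_div_n mulrA ltr_pdivrMr ?exprn_gt0// mulrC ltr_pM2l ?exprn_gt0//.
rewrite expr2 -natrM ltr_nat mulnS; exact: leq_addr.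
Qed.

(** A Lipschitz function is the infimum over rational q of the cones
    b q + L |x - q|, so its strict sublevel sets are countable unions of
    measurable sets.  Measurability of X is only known entrywise, and this
    avoids any sigma-algebra on the space of vectors. *)
Lemma measurable_lipschitz_comp d D (b : 'cV[R]_d -> R) (L : R) (X : T -> 'cV[R]_d) :
  measurable D -> 0 < L -> (forall x y, `|b x - b y| <= L * frob (x - y)) ->
  mx_measurable D X -> measurable_fun D (fun w => b (X w)).
Proof.
move=> mD L0 Lb mX.
apply: (measurability (@RGenInftyO.G R)); first exact: RGenInftyO.measurableE.
move=> _ [_ [a ->] <-].
have -> : D `&` (fun w => b (X w)) @^-1` `]-oo, a[ =
   D `&` \bigcup_(q in [set: 'cV[rat]_d]) [set w | b (map_mx ratr q) +
       L * frob (X w - map_mx ratr q) < a].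
  apply/seteqP; split=> w /= [Dw]; rewrite ?in_itv/= => h; split=> //.
    have e0 : 0 < (a - b (X w)) / (2 * L) by rewrite divr_gt0 ?subr_gt0//; lra.
    have [q hq] := rat_cvec_dense (X w) e0.
    exists q => //=.
    have := Lb (X w) (map_mx ratr q); rewrite ler_norml => /andP[h1 _].
    have : 2 * (L * frob (X w - map_mx ratr q)) < a - b (X w).
      by rewrite mulrA mulrC -ltr_pdivlMr//; lra.
    lra.
  move: h => [q _ /= h].
  have := Lb (X w) (map_mx ratr q); rewrite ler_norml => /andP[_ h1].
  lra.
rewrite setI_bigcupr; apply: countable_bigcupT_measurable.
  exact: countableP.
move=> q.
have : measurable_fun D (fun w => b (map_mx ratr q) + L * frob (X w - map_mx ratr q)).
  apply: measurable_funD; first exact: measurable_cst.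
  apply: measurable_funM; first exact: measurable_cst.
  by apply: measurable_frob; apply: mx_measurableB => //; exact: mx_measurable_cst.
move=> /(_ mD `]-oo, a[%classic (measurable_itv _)).
congr (measurable _); apply/seteqP; split=> w [Dw]/=; rewrite ?in_itv//=.
Qed.

Lemma mx_measurable_lipschitz d m n D (b : 'cV[R]_d -> 'M[R]_(m, n)) (K : R)
    (X : T -> 'cV[R]_d) : measurable D -> 0 < K ->
  (forall x y, nsq (b x - b y) <= K * nsq (x - y)) ->
  mx_measurable D X -> mx_measurable D (fun w => b (X w)).
Proof.
move=> mD K0 Kb mX i j.
apply: (@measurable_lipschitz_comp d D (fun x => b x i j) (Num.sqrt K)) => //.
  by rewrite sqrtr_gt0.
move=> x y; apply: (@le_trans _ _ (frob (b x - b y))).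
  by have := frob_entry_le (b x - b y) i j; rewrite !mxE.
rewrite !frobE -sqrtrM ?(ltW K0)// ler_sqrt//.
by rewrite mulr_ge0 ?nsq_ge0 ?ltW.
Qed.

End mx_measurability.

(** * Tonelli and reflection of Lebesgue measure *)

Section tonelli_restricted.
Context {R : realType} {disp : measure_display} {Omega : measurableType disp}.
Variable P : probability Omega R.
Local Notation mu := (@lebesgue_measure R).
Variables (D : set R) (f : R * Omega -> \bar R).
Hypothesis mD : measurable D.
Hypothesis mf : measurable_fun (D `*` setT) f.
Hypothesis f0 : forall p, (0 <= f p)%E.
Local Open Scope ereal_scope.

Let f' := f \_ (D `*` setT).

Let mf' : measurable_fun setT f'.
Proof. by apply/(measurable_restrictT _ _).1 => //; exact: measurableX. Qed.

Let f'0 p : 0 <= f' p.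
Proof. exact: erestrict_ge0. Qed.

Let f'E s w : f' (s, w) = ((fun s => f (s, w)) \_ D) s.
Proof.
rewrite /f' /restrict/=; congr (if _ then _ else _).
by apply/idP/idP; rewrite !inE => //= -[].
Qed.

Let f'F w : \int[mu]_s f' (s, w) = \int[mu]_(s in D) f (s, w).
Proof. by rewrite [RHS]integral_mkcond; apply: eq_integral => s _; rewrite f'E. Qed.

Let f'G s : \int[P]_w f' (s, w) = ((fun s => \int[P]_w f (s, w)) \_ D) s.
Proof.
under eq_integral do rewrite f'E; rewrite /restrict; case: ifPn => // _.
exact: integral0.
Qed.

Lemma tonelli_restricted :
  \int[P]_w \int[mu]_(s in D) f (s, w) = \int[mu]_(s in D) \int[P]_w f (s, w).
Proof.
under eq_integral do rewrite -f'F.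
rewrite -(@fubini_tonelli _ _ _ _ _ mu P f')// [RHS]integral_mkcond.
by apply: eq_integral => s _; rewrite f'G.
Qed.

Lemma measurable_tonelli_time : measurable_fun setT (fun w => \int[mu]_(s in D) f (s, w)).
Proof.
rewrite (_ : (fun w => _) = fun w => \int[mu]_s f' (s, w)).
  exact: (@measurable_fun_fubini_tonelli_G _ _ _ _ _ mu f').
by apply/funext => w; rewrite f'F.
Qed.

Lemma measurable_tonelli_space : measurable_fun D (fun s => \int[P]_w f (s, w)).
Proof.
apply/(measurable_restrictT _ mD).
rewrite (_ : _ \_ D = fun s => \int[P]_w f' (s, w)).
  exact: (@measurable_fun_fubini_tonelli_F _ _ _ _ _ P f').
by apply/funext => s; rewrite f'G.
Qed.

End tonelli_restricted.

Section reflection.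
Context {R : realType}.
Local Notation mu := (@lebesgue_measure R).
Local Open Scope ereal_scope.

Lemma measurable_reflect (t : R) : measurable_fun setT (fun s : R => (t - s)%R).
Proof. by apply: measurable_funB => //; exact: measurable_id. Qed.

(** Lebesgue measure is characterized by its values on half-open intervals,
    which a reflection maps to intervals of the same length. *)
Lemma lebesgue_measure_reflect (t : R) (A : set R) : measurable A ->
  mu ((fun s => (t - s)%R) @^-1` A) = mu A.
Proof.
move=> mA.
pose ph : measurableTypeR R -> measurableTypeR R := fun s => (t - s)%R.
have mph : measurable_fun setT ph by exact: measurable_reflect.
apply/esym; rewrite -[RHS]/(pushforward mu ph A).
apply: (@lebesgue_measure_unique _ (pushforward mu ph)) => //.
move=> _ [[a b] _ <-] /=.
rewrite /pushforward.
rewrite (_ : _ @^-1` _ = `[(t - b)%R, (t - a)%R[%classic).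
  rewrite !lebesgue_measure_itv/= !lte_fin.
  rewrite ltrD2l ltrN2; case: ifP => // _.
  by rewrite -!EFinB; congr EFin; lra.
by apply/seteqP; split=> s /=; rewrite !in_itv/= /ph; lra.
Qed.

Lemma integral_reflect (t : R) (D : set R) (f : R -> \bar R) :
  measurable D -> measurable_fun D f -> (forall s, D s -> 0 <= f s) ->
  \int[mu]_(s in (fun s => (t - s)%R) @^-1` D) f (t - s)%R = \int[mu]_(s in D) f s.
Proof.
move=> mD mf f0.
pose ph : measurableTypeR R -> measurableTypeR R := fun s => (t - s)%R.
have mph : measurable_fun setT ph by exact: measurable_reflect.
transitivity (\int[pushforward mu ph]_(s in D) f s).
  rewrite ge0_integral_pushforward//.
  by move=> y; rewrite inE; exact: f0.
apply: eq_measure_integral => /= A mA AD.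
exact: lebesgue_measure_reflect.
Qed.

(** The kernels of the equation enter as functions of t - s with s in [0, t),
    the error bound as an integral over (0, t]. *)
Lemma integral_convolution_reflect (t : R) (f : R -> \bar R) :
  measurable_fun (`]0%R, t] : set R) f -> (forall s, (0 < s <= t)%R -> 0 <= f s) ->
  \int[mu]_(s in `[0%R, t[) f (t - s)%R = \int[mu]_(s in `]0%R, t]) f s.
Proof.
move=> mf f0; rewrite -[RHS](@integral_reflect t)//.
  rewrite (_ : (fun s => (t - s)%R) @^-1` _ = `[0%R, t[%classic)//.
  by apply/seteqP; split=> s /=; rewrite !in_itv/=; lra.
Qed.

End reflection.

(** * Moments of Gaussian variables *)

Section integral_density.
Context {d : measure_display} {T : measurableType d} {R : realType}.
Variables (nu mu : {measure set T -> \bar R}) (g : T -> R).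
Hypothesis mg : measurable_fun setT g.
Hypothesis g0 : forall x, 0 <= g x.
Local Open Scope ereal_scope.
Hypothesis nuE : forall A, measurable A -> nu A = \int[mu]_(x in A) (g x)%:E.

Import HBNNSimple.

Let integral_density_nnsfun (h : {nnsfun T >-> R}) :
  \int[nu]_x (h x)%:E = \int[mu]_x ((h x)%:E * (g x)%:E).
Proof.
have mh (r : R) : measurable_fun setT (fun x => (r * \1_(h @^-1` [set r]) x)%:E).
  by apply/measurable_EFinP; exact: measurable_funM.
have mgE : measurable_fun setT (fun x => (g x)%:E) by exact/measurable_EFinP.
under eq_integral do rewrite fimfunE -fsumEFin//.
rewrite ge0_integral_fsum//; last by move=> r x _; exact: nnfun_muleindic_ge0.
transitivity (\int[mu]_x (\sum_(r \in range h)
    (r * \1_(h @^-1` [set r]) x)%:E * (g x)%:E)); last first.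
  apply: eq_integral => x _; rewrite -ge0_mule_fsuml => [|y]; last exact: nnfun_muleindic_ge0.
  by rewrite fsumEFin// -(fimfunE _ x).
rewrite ge0_integral_fsum//; last 2 first.
  - by move=> r; apply: emeasurable_funM => //; exact: mh.
  - by move=> r x _; apply: mule_ge0; [exact: nnfun_muleindic_ge0|rewrite lee_fin].
apply: eq_fsbigr => r rh.
under eq_integral do rewrite EFinM.
rewrite integralZl_indic_nnsfun//.
under [RHS]eq_integral do rewrite EFinM -muleA.
rewrite [RHS]ge0_integralZl//; last 3 first.
- by apply: emeasurable_funM => //; apply/measurable_EFinP.
- by move=> x _; rewrite mule_ge0 ?lee_fin ?g0.
- by move: rh; rewrite inE => -[x _ <-]; rewrite lee_fin fun_ge0.
congr (_ * _); rewrite integral_indic// setIT nuE//.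
rewrite integral_mkcond; apply: eq_integral => x _.
by rewrite /restrict/= indicE; case: ifPn => _; rewrite ?mul1e ?mul0e.
Qed.

(** The formula is checked on simple functions and passes to monotone limits. *)
Lemma ge0_integral_density (f : T -> \bar R) :
  measurable_fun setT f -> (forall x, 0 <= f x) ->
  \int[nu]_x f x = \int[mu]_x (f x * (g x)%:E).
Proof.
move=> mf f0; pose h := nnsfun_approx measurableT mf.
transitivity (lim (\int[nu]_x (h n x)%:E @[n --> \oo])).
  rewrite -monotone_convergence//.
  - by apply: eq_integral => x _; apply/esym/cvg_lim => //; exact: cvg_nnsfun_approx.
  - by move=> n; exact/measurable_EFinP.
  - by move=> n x _; rewrite lee_fin.
  - by move=> x _ a b ab; rewrite lee_fin; exact/lefP/nd_nnsfun_approx.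
transitivity (lim (\int[mu]_x ((h n x)%:E * (g x)%:E) @[n --> \oo])).
  by under eq_fun do rewrite integral_density_nnsfun.
rewrite -monotone_convergence//.
- apply: eq_integral => x _; apply/cvg_lim => //.
  by apply: cvgeZr => //; exact: cvg_nnsfun_approx.
- by move=> n; apply: emeasurable_funM; exact/measurable_EFinP.
- by move=> n x _; rewrite mule_ge0 ?lee_fin ?g0.
- move=> x _ a b ab; rewrite lee_wpmul2r ?lee_fin ?g0//.
  exact/lefP/nd_nnsfun_approx.
Qed.

End integral_density.

Section normal_moments.
Context {R : realType}.
Local Notation mu := (@lebesgue_measure R).
Local Open Scope ereal_scope.

Lemma ge0_integral_normal_prob (m s : R) (f : R -> \bar R) :
  measurable_fun setT f -> (forall x, 0 <= f x) ->
  \int[normal_prob m s]_x f x = \int[mu]_x (f x * (normal_pdf m s x)%:E).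
Proof.
move=> mf f0; apply: ge0_integral_density => //.
- exact: measurable_normal_pdf.
- exact: normal_pdf_ge0.
Qed.

(** The second moment of the standard normal law.  Its value is 1, but the
    estimates only need a finite number, the same for all probability spaces. *)
Definition gauss_second_moment : R :=
  fine (\int[mu]_x ((x ^+ 2)%:E * (normal_pdf 0%R 1%R x)%:E)).

Let gauss_second_moment_lty :
  \int[mu]_x ((x ^+ 2)%:E * (normal_pdf 0%R 1%R x)%:E) < +oo.
Proof.
have s20 : Num.sqrt 2 != 0%R :> R by rewrite gt_eqF// sqrtr_gt0.
pose c : R := (4 * normal_peak 1 / normal_peak (Num.sqrt 2))%R.
have pk0 : (0 < normal_peak (Num.sqrt 2) :> R)%R by exact: normal_peak_gt0.
have c0 : (0 <= c)%R by rewrite /c !mulr_ge0 ?normal_peak_ge0 ?invr_ge0 ?normal_peak_ge0.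
apply: (@le_lt_trans _ _ (\int[mu]_x (c%:E * (normal_pdf 0%R (Num.sqrt 2) x)%:E))).
  apply: ge0_le_integral => //=.
  - by move=> x _; rewrite -EFinM lee_fin mulr_ge0 ?sqr_ge0 ?normal_pdf_ge0.
  - apply: emeasurable_funM; apply/measurable_EFinP => //.
    exact: measurable_normal_pdf.
  - by apply: emeasurable_funM => //; apply/measurable_EFinP; exact: measurable_normal_pdf.
  move=> x _; rewrite -!EFinM lee_fin !normal_pdfE ?oner_eq0// /normal_fun !subr0.
  rewrite sqr_sqrtr//; set E := expR (- x ^+ 2 / (2 *+ 2)).
  have -> : expR (- x ^+ 2 / (1 ^+ 2 *+ 2)) = (E * E)%R.
    by rewrite -expRD; congr expR; rewrite expr1n; field.
  have E0 : (0 < E)%R by exact: expR_gt0.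
  (* x ^ 2 <= 4 (1 + x ^ 2 / 4) <= 4 exp (x ^ 2 / 4) *)
  have xE : (x ^+ 2 * E <= 4)%R.
    rewrite /E mulNr expRN ler_pdivrMr ?expR_gt0//.
    by have := expR_ge1Dx (x ^+ 2 / (2 *+ 2)); lra.
  have -> : (c * (normal_peak (Num.sqrt 2) * E) = 4 * (normal_peak 1 * E))%R.
    by rewrite /c; field; rewrite gt_eqF.
  have -> : (x ^+ 2 * (normal_peak 1 * (E * E)) = (x ^+ 2 * E) * (normal_peak 1 * E))%R.
    by ring.
  by rewrite ler_wpM2r// mulr_ge0 ?normal_peak_ge0// ltW.
rewrite ge0_integralZl//.
- by rewrite integral_normal_pdf mule1 ltry.
- by apply/measurable_EFinP; exact: measurable_normal_pdf.
- by move=> x _; rewrite lee_fin normal_pdf_ge0.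
Qed.

Lemma gauss_second_moment_ge0 : (0 <= gauss_second_moment)%R.
Proof.
rewrite fine_ge0// integral_ge0// => x _.
by rewrite mule_ge0 ?lee_fin ?sqr_ge0 ?normal_pdf_ge0.
Qed.

(** Substitution x = s y reduces the variance s ^ 2 to the variance 1. *)
Lemma second_moment_normal (s : R) : (0 < s)%R ->
  \int[normal_prob 0%R s]_x (x ^+ 2)%:E = (gauss_second_moment * s ^+ 2)%:E.
Proof.
move=> s0; rewrite ge0_integral_normal_prob//; last 2 first.
- exact/measurable_EFinP.
- by move=> x; rewrite lee_fin sqr_ge0.
have sN0 : s != 0%R by rewrite gt_eqF.
pose G (y : R) : R := (y ^+ 2 * normal_pdf 0%R 1%R y)%R.
pose F (x : R) : R := (x / s)%R.
have dF x : derivable F x 1 by exact: derivableM.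
have F'E : F^`()%classic = cst (s^-1)%R.
  apply/funext => x; rewrite /F derive1E deriveM// derive_cst scaler0 add0r.
  by rewrite derive_id scaler1.
rewrite EFinM /gauss_second_moment fineK; last first.
  rewrite ge0_fin_numE ?gauss_second_moment_lty// integral_ge0// => x _.
  by rewrite mule_ge0 ?lee_fin ?sqr_ge0 ?normal_pdf_ge0.
have -> : \int[mu]_x ((x ^+ 2)%:E * (normal_pdf 0%R 1%R x)%:E) = \int[mu]_x (G x)%:E.
  by apply: eq_integral => x _; rewrite -EFinM.
have mG : measurable_fun setT G.
  by apply: measurable_funM => //; exact: measurable_normal_pdf.
have mF : measurable_fun setT F by exact: measurable_funM.
have subst : \int[mu]_x (G x)%:E = \int[mu]_x (((G \o F) * F^`()%classic)%R x)%:E.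
  apply: (@increasing_ge0_integration_by_substitutionT _ F G).
  - by move=> x y xy; rewrite /F ltr_pM2r// invr_gt0.
  - by rewrite F'E => ?; exact: cvg_cst.
  - by rewrite F'E; exact: is_cvg_cst.
  - by rewrite F'E; exact: is_cvg_cst.
  - exact: dF.
  - by apply/gt0_cvgMlNy; [rewrite invr_gt0|exact: cvg_id].
  - by apply/gt0_cvgMly; [rewrite invr_gt0|exact: cvg_id].
  - move=> x; apply: cvgM; first exact: sqr_continuous.
    by apply: continuous_normal_pdf; rewrite oner_eq0.
  - by move=> x; rewrite mulr_ge0 ?sqr_ge0 ?normal_pdf_ge0.
rewrite {}subst.
have mGF : measurable_fun setT (((G \o F) \* F^`()%classic)%R).
  rewrite F'E; apply: measurable_funM => //.
  exact: (measurableT_comp mG mF).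
rewrite muleC -ge0_integralZl ?lee_fin ?sqr_ge0//; last 2 first.
- exact/measurable_EFinP.
- by move=> x _; rewrite F'E/= lee_fin mulr_ge0 ?invr_ge0 ?(ltW s0)// mulr_ge0 ?sqr_ge0 ?normal_pdf_ge0.
apply: eq_integral => x _; rewrite -!EFinM F'E /G /F/=.
congr EFin; rewrite !normal_pdfE ?oner_eq0// /normal_fun /normal_peak !fctE/=.
rewrite !subr0 !expr1n mul1r -mulrnAr sqrtrM ?sqr_ge0// sqrtr_sqr gtr0_norm// invfM.
have -> : (- (x / s) ^+ 2 / (1 *+ 2) = - x ^+ 2 / (s ^+ 2 *+ 2))%R by field.
have sp0 : Num.sqrt (pi *+ 2) != 0%R :> R.
  by rewrite gt_eqF// sqrtr_gt0 mulrn_wgt0// pi_gt0.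
by field; rewrite sN0 sp0.
Qed.

Lemma normal_prob0_symmetric (s : R) (f : R -> \bar R) : s != 0%R ->
  measurable_fun setT f -> (forall x, 0 <= f x) ->
  \int[normal_prob 0%R s]_x f (- x)%R = \int[normal_prob 0%R s]_x f x.
Proof.
move=> s0 mf f0.
have mg : measurable_fun setT (fun x => f x * (normal_pdf 0%R s x)%:E).
  by apply: emeasurable_funM => //; apply/measurable_EFinP; exact: measurable_normal_pdf.
rewrite !ge0_integral_normal_prob//; last exact: measurableT_comp.
have h0 x : [set: R] x -> 0 <= f x * (normal_pdf 0%R s x)%:E.
  by move=> _; rewrite mule_ge0// lee_fin normal_pdf_ge0.
have := integral_reflect 0%R measurableT mg h0; rewrite preimage_setT => <-.
apply: eq_integral => x _.
by rewrite sub0r !normal_pdfE// /normal_fun !subr0 sqrrN.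
Qed.

End normal_moments.
Arguments gauss_second_moment : clear implicits.

(** * Gaussian variables and independence *)

Section gaussian_random_variable.
Context {disp : measure_display} {Omega : measurableType disp} {R : realType}.
Variables (P : probability Omega R) (Z : Omega -> R) (s : R).
Hypotheses (mZ : measurable_fun setT Z) (s0 : 0 < s).
Hypothesis lawZ : forall B, measurable B -> P (Z @^-1` B) = normal_prob 0 s B.
Local Open Scope ereal_scope.

Lemma ge0_integral_gaussian (f : R -> \bar R) :
  measurable_fun setT f -> (forall x, 0 <= f x) ->
  \int[P]_w f (Z w) = \int[normal_prob 0%R s]_x f x.
Proof.
move=> mf f0.
transitivity (\int[pushforward P (Z : Omega -> measurableTypeR R)]_x f x).
  by rewrite ge0_integral_pushforward// preimage_setT.
by apply: eq_measure_integral => B mB _; exact: lawZ.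
Qed.

Lemma gaussian_second_moment :
  \int[P]_w (Z w ^+ 2)%:E = (gauss_second_moment R * s ^+ 2)%:E.
Proof.
rewrite -second_moment_normal// (@ge0_integral_gaussian (fun x => (x ^+ 2)%:E))//.
- exact/measurable_EFinP.
- by move=> x; rewrite lee_fin sqr_ge0.
Qed.

Lemma gaussian_sqr_integrable : P.-integrable setT (fun w => (Z w ^+ 2)%:E).
Proof.
apply/integrableP; split; first by apply/measurable_EFinP; exact: measurable_funX.
under eq_integral do rewrite gee0_abs ?lee_fin ?sqr_ge0//.
by rewrite gaussian_second_moment ltry.
Qed.

Lemma gaussian_integrable : P.-integrable setT (fun w => (Z w)%:E).
Proof.
apply: (@le_integrable _ _ _ P setT measurableT _ (fun w => (1 + Z w ^+ 2)%:E)).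
- exact/measurable_EFinP.
- move=> w _; rewrite /= lee_fin [leRHS]ger0_norm ?addr_ge0 ?sqr_ge0//.
  have := sqr_ge0 (`|Z w| - 1)%R; have := normr_ge0 (Z w).
  by rewrite -(real_normK (num_real (Z w))) sqrrB1; lra.
- under eq_fun do rewrite EFinD.
  apply: integrableD => //; last exact: gaussian_sqr_integrable.
  exact: finite_measure_integrable_cst.
Qed.

(** The law of Z is symmetric, so the positive and the negative part of Z have
    the same integral. *)
Lemma gaussian_mean0 : (\int[P]_w Z w = 0)%R.
Proof.
have mmax : measurable_fun setT (fun x : R => (Num.max x 0)%:E).
  by apply/measurable_EFinP; exact: measurable_maxr.
rewrite /Rintegral integralE.
have -> : \int[P]_w (fun w => (Z w)%:E)^\- w = \int[P]_w (fun w => (Z w)%:E)^\+ w.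
  have E1 : \int[P]_w (fun w => (Z w)%:E)^\+ w = \int[P]_w (Num.max (Z w) 0)%:E.
    by apply: eq_integral => w _; rewrite funeposE EFin_max.
  have E2 : \int[P]_w (fun w => (Z w)%:E)^\- w = \int[P]_w (Num.max (- Z w) 0)%:E.
    by apply: eq_integral => w _; rewrite funenegE EFin_max.
  rewrite E1 E2.
  rewrite (@ge0_integral_gaussian (fun x => (Num.max x 0)%:E))//; last first.
    by move=> x; rewrite lee_fin le_max lexx orbT.
  rewrite (@ge0_integral_gaussian (fun x => (Num.max (- x) 0)%:E))//; last 2 first.
  - by apply: (measurableT_comp mmax); exact: oppr_measurable.
  - by move=> x; rewrite lee_fin le_max lexx orbT.
  rewrite (@normal_prob0_symmetric _ _ (fun x => (Num.max x 0)%:E))//.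
    by rewrite gt_eqF.
  by move=> x; rewrite lee_fin le_max lexx orbT.
have h : \int[P]_w (fun w => (Z w)%:E)^\+ w \is a fin_num.
  by have /integral_fune_fin_num := integrable_funepos measurableT gaussian_integrable; exact.
by rewrite subee.
Qed.

End gaussian_random_variable.

(** Independence, given as a product rule on rectangles, says that the joint
    law of Y and Z is the product of their laws; Fubini then factorizes the
    integral of the product. *)
Section independent_product.
Context {disp : measure_display} {Omega : measurableType disp} {R : realType}.
Variables (P : probability Omega R) (Y Z : Omega -> R).
Hypothesis indepYZ : forall A B, measurable A -> measurable B ->
  P (Y @^-1` A `&` Z @^-1` B) = (P (Y @^-1` A) * P (Z @^-1` B))%E.
Hypotheses (iY : P.-integrable setT (EFin \o Y)) (iZ : P.-integrable setT (EFin \o Z)).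
Local Open Scope ereal_scope.

Let mY : measurable_fun setT Y. Proof. by apply/measurable_EFinP; exact: measurable_int iY. Qed.
Let mZ : measurable_fun setT Z. Proof. by apply/measurable_EFinP; exact: measurable_int iZ. Qed.
Let Y' : {mfun Omega >-> R} := HB.pack Y (isMeasurableFun.Build _ _ _ _ _ mY).
Let Z' : {mfun Omega >-> R} := HB.pack Z (isMeasurableFun.Build _ _ _ _ _ mZ).
Let PY := distribution P Y'.
Let PZ := distribution P Z'.
Let YZ (w : Omega) : R * R := (Y w, Z w).

Let mYZ : measurable_fun setT YZ.
Proof. exact: measurable_fun_pair. Qed.

Let joint_law (A : set (R * R)) : measurable A ->
  (PY \x PZ) A = pushforward P YZ A.
Proof.
apply: product_measure_unique => B C mB mC.
by rewrite /pushforward -indepYZ.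
Qed.

Let f (p : R * R) : \bar R := (p.1 * p.2)%:E.

Let mf : measurable_fun setT f.
Proof. by apply/measurable_EFinP; apply: measurable_funM. Qed.

Let iPY : PY.-integrable setT EFin.
Proof.
by apply: integrable_pushforward => //; rewrite ?preimage_setT//; exact: EFin_measurable.
Qed.

Let iPZ : PZ.-integrable setT EFin.
Proof.
by apply: integrable_pushforward => //; rewrite ?preimage_setT//; exact: EFin_measurable.
Qed.

Let if_prod : (PY \x PZ).-integrable setT f.
Proof.
have mabs : measurable_fun setT (fun y : R => `|y|%:E).
  by apply/measurable_EFinP; exact: normr_measurable.
apply/integrable12ltyP => //.
have -> : \int[PY]_x \int[PZ]_y `|f (x, y)| =
    \int[PY]_x (`|x|%:E * \int[PZ]_y `|y|%:E).
  apply: eq_integral => x _; rewrite -ge0_integralZl//.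
  by apply: eq_integral => y _; rewrite /f/= normrM EFinM.
rewrite ge0_integralZr//; last exact: integral_ge0.
by rewrite lte_mul_pinfty ?integral_ge0// ?ge0_fin_numE ?integral_ge0//;
  [case/integrableP: iPY|case/integrableP: iPZ].
Qed.

Lemma integrable_independentM : P.-integrable setT (fun w => (Y w * Z w)%:E).
Proof.
apply/integrableP; split; first by apply/measurable_EFinP; exact: measurable_funM.
case/integrableP : if_prod => _; congr (_ < _).
transitivity (\int[pushforward P YZ]_p `|f p|).
  by apply: eq_measure_integral => A mA _; exact: joint_law.
by rewrite ge0_integral_pushforward ?preimage_setT//; exact: measurableT_comp.
Qed.

Lemma Rintegral_independentM :
  (\int[P]_w (Y w * Z w) = (\int[P]_w Y w) * (\int[P]_w Z w))%R.
Proof.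
rewrite /Rintegral.
transitivity (fine (\int[pushforward P YZ]_p f p)).
  rewrite (@integral_pushforward _ _ _ _ _ _ mYZ)// preimage_setT//.
  exact: integrable_independentM.
transitivity (fine (\int[PY \x PZ]_p f p)).
  congr fine; apply: eq_measure_integral => A mA _.
  by apply/esym; exact: joint_law.
rewrite -integral12_prod_meas1//= /fubini_F/f/=.
have -> : \int[PY]_x \int[PZ]_y (x * y)%:E = \int[PY]_x (x%:E * (fine (\int[PZ]_y y%:E))%:E).
  apply: eq_integral => x _; rewrite fineK; last exact: integrable_fin_num iPZ.
  by rewrite -integralZl//; apply: eq_integral => y _; rewrite EFinM.
rewrite integralZr// fineM//; last exact: integrable_fin_num iPY.
rewrite /PY /PZ (integral_distribution (P := P) (X := Y') (f := EFin))//=.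
by rewrite (integral_distribution (P := P) (X := Z') (f := EFin))//=.
Qed.

End independent_product.

(** * Products of Brownian increments *)

Section integration_helpers.
Context {d : measure_display} {T : measurableType d} {R : realType}.
Variables (mu : {measure set T -> \bar R}) (D : set T).
Hypothesis mD : measurable D.

Lemma integrable_dominated (f g : T -> R) :
  measurable_fun D f -> mu.-integrable D (EFin \o g) ->
  (forall x, D x -> `|f x| <= g x) -> mu.-integrable D (EFin \o f).
Proof.
move=> mf ig fg; apply: le_integrable ig => //; first exact/measurable_EFinP.
by move=> x Dx; rewrite /= lee_fin (le_trans (fg _ Dx))// ler_norm.
Qed.

Lemma integrable_cst_lty (k : R) : (mu D < +oo)%E -> mu.-integrable D (EFin \o cst k).
Proof.
move=> D_lty; apply/integrableP; split; first exact/measurable_EFinP.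
rewrite (eq_integral (cst `|k|%:E))// integral_cst//.
by rewrite lte_mul_pinfty// lee_fin.
Qed.

Lemma EFin_Rintegral (f : T -> R) : mu.-integrable D (EFin \o f) ->
  (\int[mu]_(x in D) f x)%:E = (\int[mu]_(x in D) (f x)%:E)%E.
Proof. by move=> fi; rewrite fineK//; exact: integrable_fin_num fi. Qed.

Lemma integrable_addR (f g : T -> R) :
  mu.-integrable D (EFin \o f) -> mu.-integrable D (EFin \o g) ->
  mu.-integrable D (EFin \o (fun x => f x + g x)).
Proof. by move=> fi gi; exact: (integrableD mD fi gi). Qed.

Lemma integrable_scaleR (k : R) (f : T -> R) :
  mu.-integrable D (EFin \o f) -> mu.-integrable D (EFin \o (fun x => k * f x)).
Proof. by move=> fi; exact: (integrableZl mD k fi). Qed.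

Lemma integrable_sumR (I : Type) (r : seq I) (f : I -> T -> R) :
  (forall i, mu.-integrable D (EFin \o f i)) ->
  mu.-integrable D (EFin \o (fun x => \sum_(i <- r) f i x)).
Proof.
move=> fi; rewrite (_ : EFin \o _ = fun x => (\sum_(i <- r) (EFin \o f i) x)%E).
  by apply: integrable_sum => // i _; exact: fi.
by apply/funext => x; rewrite /= sumEFin.
Qed.

Lemma Rintegral_sum (I : Type) (r : seq I) (f : I -> T -> R) :
  (forall i, mu.-integrable D (EFin \o f i)) ->
  \int[mu]_(x in D) (\sum_(i <- r) f i x) = \sum_(i <- r) \int[mu]_(x in D) f i x.
Proof.
move=> fi; elim: r => [|i r IH].
  under eq_Rintegral do rewrite big_nil.
  by rewrite big_nil Rintegral_cst// mul0r.
rewrite big_cons -IH -RintegralD//; last exact: integrable_sumR.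
by apply: eq_Rintegral => x _; rewrite big_cons.
Qed.

End integration_helpers.

(** The scalar version of [mx_measurable_wrt]. *)
Definition measurable_wrt (Omega : Type) (R : realType) (G : set_system Omega)
    (Y : Omega -> R) : Prop :=
  forall B : set R, measurable B -> G (Y @^-1` B).

Section measurable_wrt_theory.
Context {disp : measure_display} {Omega : measurableType disp} {R : realType}.
Variable G : set_system Omega.
Hypothesis sG : sigma_algebra setT G.

Let G_measurable (Y : g_sigma_algebraType G -> R) :
  measurable_wrt G Y <-> measurable_fun setT Y.
Proof.
split=> [mY _ B mB|mY B mB].
  by rewrite setTI; rewrite measurable_g_measurableTypeE//; exact: mY.
have := mY measurableT B mB; rewrite setTI.
by rewrite measurable_g_measurableTypeE.
Qed.

Lemma measurable_wrtM (Y Z : Omega -> R) :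
  measurable_wrt G Y -> measurable_wrt G Z -> measurable_wrt G (fun w => Y w * Z w).
Proof.
move=> /G_measurable mY /G_measurable mZ; apply/G_measurable.
exact: measurable_funM.
Qed.

Lemma measurable_wrtB (Y Z : Omega -> R) :
  measurable_wrt G Y -> measurable_wrt G Z -> measurable_wrt G (fun w => Y w - Z w).
Proof.
move=> /G_measurable mY /G_measurable mZ; apply/G_measurable.
exact: measurable_funB.
Qed.

Lemma measurable_wrt_cst (c : R) : measurable_wrt G (cst c : Omega -> R).
Proof. by apply/G_measurable; exact: measurable_cst. Qed.

End measurable_wrt_theory.

Section brownian_coordinate.
Context {disp : measure_display} {Omega : measurableType disp} {R : realType} {d : nat}.
Variables (P : probability Omega R) (F : R -> set_system Omega).
Variables (W : R -> Omega -> 'cV[R]_d) (j : 'I_d).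
Hypotheses (hF : is_filtration F) (hW : is_brownian P F W).

(** The increment of one coordinate of W.  Different coordinates are never
    multiplied in what follows. *)
Definition bincr (s t : R) (w : Omega) : R := W t w j 0 - W s w j 0.

Lemma measurable_wrt_mono s t (Y : Omega -> R) : 0 <= s -> s <= t ->
  measurable_wrt (F s) Y -> measurable_wrt (F t) Y.
Proof. by move=> s0 st mY B mB; apply: (filtration_mono hF s0 st); exact: mY. Qed.

Lemma measurable_wrt_measurable s (Y : Omega -> R) : 0 <= s ->
  measurable_wrt (F s) Y -> measurable_fun setT Y.
Proof.
by move=> s0 mY _ B mB; rewrite setTI; apply: (filtration_sub hF s0); exact: mY.
Qed.

Lemma bincr_wrt s t : 0 <= s -> s <= t -> measurable_wrt (F t) (bincr s t).
Proof.
move=> s0 st; have t0 := le_trans s0 st.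
apply: measurable_wrtB; first exact: filtration_sigma.
  by move=> B mB; exact: (brownian_adapted hW).
apply: (measurable_wrt_mono s0 st).
by move=> B mB; exact: (brownian_adapted hW).
Qed.

Lemma measurable_bincr s t : 0 <= s -> s <= t -> measurable_fun setT (bincr s t).
Proof.
move=> s0 st; apply: (@measurable_wrt_measurable t); first exact: le_trans st.
exact: bincr_wrt.
Qed.

Let box (B : set R) : 'I_d -> set R := fun i => if i == j then B else setT.

Let measurable_box B : measurable B -> forall i, measurable (box B i).
Proof. by move=> mB i; rewrite /box; case: ifP. Qed.

Let increment_box s t B : increment_in W s t (box B) = bincr s t @^-1` B.
Proof.
apply/seteqP; split=> w /=; rewrite /increment_in/= /bincr.
  by move=> /(_ j); rewrite /box eqxx !mxE.
by move=> h i; rewrite /box; case: eqP => // ->; rewrite !mxE.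
Qed.

(** In the box event all the coordinates but j are left free. *)
Lemma bincr_law s t B : 0 <= s -> s < t -> measurable B ->
  P (bincr s t @^-1` B) = normal_prob 0 (Num.sqrt (t - s)) B.
Proof.
move=> s0 st mB; rewrite -increment_box (brownian_normal hW)//; last exact: measurable_box.
rewrite (bigD1 j)//= big1 ?mule1; first by rewrite /box eqxx.
by move=> i ij; rewrite /box (negbTE ij) probability_setT.
Qed.

Lemma bincr_indep s t (Y : Omega -> R) A B : 0 <= s -> s < t ->
  measurable_wrt (F s) Y -> measurable A -> measurable B ->
  (P (Y @^-1` A `&` bincr s t @^-1` B) = P (Y @^-1` A) * P (bincr s t @^-1` B))%E.
Proof.
move=> s0 st mY mA mB; rewrite -increment_box.
by apply: (brownian_independent hW) => //; [exact: mY|exact: measurable_box].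
Qed.

Lemma bincrxx s w : bincr s s w = 0.
Proof. by rewrite /bincr subrr. Qed.

Local Notation int Y := (P.-integrable setT (EFin \o Y)).

(** Orthogonality: an increment is centered and independent of the past. *)
Lemma bincr_mean s t (Y : Omega -> R) : 0 <= s -> s <= t ->
  measurable_wrt (F s) Y -> int Y ->
  int (fun w => Y w * bincr s t w) /\ \int[P]_w (Y w * bincr s t w) = 0.
Proof.
move=> s0; rewrite le_eqVlt => /predU1P[<-|st] mY iY.
  have E : (fun w => Y w * bincr s s w) = cst 0.
    by apply/funext => w; rewrite bincrxx mulr0.
  by rewrite E Rintegral_cst//= mul0r; split=> //; exact: finite_measure_integrable_cst.
have sq0 : 0 < Num.sqrt (t - s) by rewrite sqrtr_gt0 subr_gt0.
have mZ := measurable_bincr s0 (ltW st).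
have law B : measurable B -> P (bincr s t @^-1` B) = normal_prob 0 (Num.sqrt (t - s)) B.
  exact: bincr_law.
have iZ := gaussian_integrable mZ sq0 law.
have ind A B := @bincr_indep s t Y A B s0 st mY.
split; first exact: integrable_independentM.
by rewrite Rintegral_independentM// (gaussian_mean0 mZ sq0 law) mulr0.
Qed.

(** The variance of an increment, independent of the past, grows linearly in
    time. *)
Lemma bincr_sqr s t (Y : Omega -> R) : 0 <= s -> s <= t ->
  measurable_wrt (F s) Y -> int Y ->
  int (fun w => Y w * bincr s t w ^+ 2) /\
  \int[P]_w (Y w * bincr s t w ^+ 2) =
    gauss_second_moment R * (t - s) * \int[P]_w Y w.
Proof.
move=> s0; rewrite le_eqVlt => /predU1P[<-|st] mY iY.
  have E : (fun w => Y w * bincr s s w ^+ 2) = cst 0.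
    by apply/funext => w; rewrite bincrxx expr0n mulr0.
  rewrite E Rintegral_cst//= mul0r subrr mulr0 mul0r.
  by split=> //; exact: finite_measure_integrable_cst.
have sq0 : 0 < Num.sqrt (t - s) by rewrite sqrtr_gt0 subr_gt0.
have mZ := measurable_bincr s0 (ltW st).
have law B : measurable B -> P (bincr s t @^-1` B) = normal_prob 0 (Num.sqrt (t - s)) B.
  exact: bincr_law.
have iZ := gaussian_sqr_integrable mZ sq0 law.
have ind A B : measurable A -> measurable B ->
    (P (Y @^-1` A `&` (fun w => bincr s t w ^+ 2)%R @^-1` B) =
     P (Y @^-1` A) * P ((fun w => bincr s t w ^+ 2)%R @^-1` B))%E.
  move=> mA mB.
  have mB' : measurable ((fun x : R => x ^+ 2) @^-1` B).
    by rewrite -[X in measurable X]setTI; exact: exprn_measurable.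
  exact: (@bincr_indep s t Y A _ s0 st mY mA mB').
split; first exact: (integrable_independentM ind).
rewrite (Rintegral_independentM ind)// mulrC; congr (_ * _).
rewrite /Rintegral (gaussian_second_moment mZ sq0 law)/= sqr_sqrtr//.
by rewrite subr_ge0 ltW.
Qed.

Lemma bincr_sqr_integrable s t : 0 <= s -> s <= t ->
  int (fun w => bincr s t w ^+ 2).
Proof.
move=> s0 st.
have m1 : measurable_wrt (F s) (cst 1 : Omega -> R).
  by apply: measurable_wrt_cst; exact: (filtration_sigma hF).
have i1 : int (cst 1 : Omega -> R) by exact: finite_measure_integrable_cst.
have [i2 _] := bincr_sqr s0 st m1 i1.
by apply: eq_integrable i2 => // w _; rewrite /= mul1r.
Qed.

Definition bounded_rv (a : Omega -> R) := exists K : R, forall w, `|a w| <= K.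

Lemma bounded_rvM a b : bounded_rv a -> bounded_rv b ->
  bounded_rv (fun w => a w * b w).
Proof.
move=> [K aK] [L bL]; exists (K * L) => w; rewrite normrM.
by apply: ler_pM.
Qed.

Lemma bincr_prod_integrable a s t s' t' : 0 <= s -> s <= t -> 0 <= s' -> s' <= t' ->
  measurable_fun setT a -> bounded_rv a ->
  int (fun w => a w * (bincr s t w * bincr s' t' w)).
Proof.
move=> s0 st s'0 st' ma [K aK].
apply: (@integrable_dominated _ _ _ P setT measurableT _
    (fun w => K * (bincr s t w ^+ 2 + bincr s' t' w ^+ 2))) => //.
- by apply: measurable_funM => //; apply: measurable_funM; exact: measurable_bincr.
- apply: integrable_scaleR => //; apply: integrable_addR => //;
  exact: bincr_sqr_integrable.
- move=> w _; rewrite normrM ler_pM// normrM.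
  rewrite -(real_normK (num_real (bincr s t w))) -(real_normK (num_real (bincr s' t' w))).
  have := sqr_ge0 (`|bincr s t w| - `|bincr s' t' w|).
  have := normr_ge0 (bincr s t w); have := normr_ge0 (bincr s' t' w).
  nra.
Qed.

Lemma bounded_bincr_integrable a s t : 0 <= s -> s <= t ->
  measurable_fun setT a -> bounded_rv a -> int (fun w => a w * bincr s t w).
Proof.
move=> s0 st ma [K aK].
apply: (@integrable_dominated _ _ _ P setT measurableT _
    (fun w => K * (1 + bincr s t w ^+ 2))) => //.
- by apply: measurable_funM => //; exact: measurable_bincr.
- apply: integrable_scaleR => //; apply: integrable_addR => //.
    exact: finite_measure_integrable_cst.
  exact: bincr_sqr_integrable.
- move=> w _; rewrite normrM ler_pM//.
  rewrite -(real_normK (num_real (bincr s t w))).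
  have := sqr_ge0 (`|bincr s t w| - 1).
  have := normr_ge0 (bincr s t w); nra.
Qed.

Lemma bounded_integrable a : measurable_fun setT a -> bounded_rv a -> int a.
Proof.
move=> ma [K aK]; apply: (@integrable_dominated _ _ _ P setT measurableT _ (cst K)) => //.
exact: finite_measure_integrable_cst.
Qed.

Lemma bincr_addition s r t w : bincr s t w = bincr s r w + bincr r t w.
Proof. by rewrite /bincr; ring. Qed.

(** Cutting the longer increment at m leaves a square and a product whose last
    factor is independent of the others. *)
Let covariance_same_left c u m M : 0 <= u -> u <= m -> m <= M ->
  measurable_wrt (F u) c -> bounded_rv c ->
  \int[P]_w (c w * (bincr u m w * bincr u M w)) =
    gauss_second_moment R * (m - u) * \int[P]_w c w.
Proof.
move=> u0 um mM mc bc.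
have m0 := le_trans u0 um.
have mc' := measurable_wrt_measurable u0 mc.
have ic := bounded_integrable mc' bc.
have [i1 E1] := bincr_sqr u0 um mc ic.
have mcm : measurable_wrt (F m) (fun w => c w * bincr u m w).
  apply: measurable_wrtM; first exact: (filtration_sigma hF).
    exact: measurable_wrt_mono mc.
  exact: bincr_wrt.
have [i2 E2] := bincr_mean m0 mM mcm (bounded_bincr_integrable u0 um mc' bc).
transitivity (\int[P]_w (c w * bincr u m w ^+ 2 + c w * bincr u m w * bincr m M w)).
  by apply: eq_Rintegral => w _; rewrite (bincr_addition u m M); ring.
by rewrite RintegralD// E1 E2 addr0.
Qed.

(** The length of the intersection of (u, v] and (u', v']. *)
Definition overlap (u v u' v' : R) : R :=
  Num.max 0 (Num.min v v' - Num.max u u').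

Lemma overlapC u v u' v' : overlap u v u' v' = overlap u' v' u v.
Proof. by rewrite /overlap minC (maxC u). Qed.

Let covariance_bincr_sorted a a' u v u' v' :
  0 <= u -> u <= v -> u <= u' -> u' <= v' ->
  measurable_wrt (F u) a -> bounded_rv a ->
  measurable_wrt (F u') a' -> bounded_rv a' ->
  \int[P]_w (a w * a' w * (bincr u v w * bincr u' v' w)) =
    gauss_second_moment R * overlap u v u' v' * \int[P]_w (a w * a' w).
Proof.
move=> u0 uv uu' uv' ma ba ma' ba'.
have u'0 := le_trans u0 uu'; have v0 := le_trans u0 uv.
have v'0 := le_trans u'0 uv'.
have mc : measurable_wrt (F u') (fun w => a w * a' w).
  apply: measurable_wrtM => //; first exact: (filtration_sigma hF).
  exact: measurable_wrt_mono ma.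
have bc := bounded_rvM ba ba'.
have mc' := measurable_wrt_measurable u'0 mc.
have past m : u <= m -> m <= u' ->
    \int[P]_w (a w * a' w * bincr u m w * bincr u' v' w) = 0 /\
    int (fun w => a w * a' w * bincr u m w * bincr u' v' w).
  move=> um mu'; have m0 := le_trans u0 um.
  have mY : measurable_wrt (F u') (fun w => a w * a' w * bincr u m w).
    apply: measurable_wrtM => //; first exact: (filtration_sigma hF).
    by apply: (measurable_wrt_mono m0) => //; exact: bincr_wrt.
  by have [] := bincr_mean u'0 uv' mY (bounded_bincr_integrable u0 um mc' bc).
have [vu'|u'v] := leP v u'.
  have -> : overlap u v u' v' = 0.
    by rewrite /overlap (max_r uu'); apply: max_l; rewrite subr_le0 ge_min vu'.
  rewrite mulr0 mul0r; have [<- _] := past v uv vu'.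
  by apply: eq_Rintegral => w _; ring.
have [E1 i1] := past u' uu' (lexx _).
have i2 := bincr_prod_integrable u'0 (ltW u'v) u'0 uv' mc' bc.
transitivity (\int[P]_w (a w * a' w * bincr u u' w * bincr u' v' w +
    a w * a' w * (bincr u' v w * bincr u' v' w))).
  by apply: eq_Rintegral => w _; rewrite (bincr_addition u u' v); ring.
rewrite RintegralD// E1 add0r /overlap (max_r uu').
have [vv'|v'v] := leP v v'.
  by rewrite max_r ?subr_ge0 ?(ltW u'v)// covariance_same_left// ltW.
rewrite max_r ?subr_ge0// -(@covariance_same_left _ u' v' v)//; last exact: ltW.
by apply: eq_Rintegral => w _; rewrite [bincr u' v w * _]mulrC.
Qed.

(** The increment over the union of adjacent intervals is a sum, so both
    increments can be cut at the end points of the other interval.  Only the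
    square of the increment over the common part survives: in every other
    product the later factor is centered and independent of the rest. *)
Lemma covariance_bincr a a' u v u' v' :
  0 <= u -> u <= v -> 0 <= u' -> u' <= v' ->
  measurable_wrt (F u) a -> bounded_rv a ->
  measurable_wrt (F u') a' -> bounded_rv a' ->
  \int[P]_w (a w * a' w * (bincr u v w * bincr u' v' w)) =
    gauss_second_moment R * overlap u v u' v' * \int[P]_w (a w * a' w).
Proof.
move=> u0 uv u'0 uv' ma ba ma' ba'.
have [uu'|/ltW u'u] := leP u u'; first exact: covariance_bincr_sorted.
rewrite overlapC.
transitivity (\int[P]_w (a' w * a w * (bincr u' v' w * bincr u v w))).
  by apply: eq_Rintegral => w _; ring.
rewrite covariance_bincr_sorted//; congr (_ * _).
by apply: eq_Rintegral => w _; ring.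
Qed.

End brownian_coordinate.

(** * The Ito isometry for simple processes *)

Section indicator_overlap.
Context {R : realType}.
Local Notation mu := (@lebesgue_measure R).

Lemma lebesgue_bounded_itv_lty (b1 b2 : bool) (x y : R) :
  (mu [set` Interval (BSide b1 x) (BSide b2 y)] < +oo)%E.
Proof. by rewrite lebesgue_measure_itv/=; case: ifP => // _; exact: ltry. Qed.

Lemma integrable_indic_itv (t u v u' v' : R) :
  mu.-integrable `[0, t[ (EFin \o (fun s => \1_(`]u, v]%classic) s * \1_(`]u', v']%classic) s)).
Proof.
apply: (@integrable_dominated _ _ _ mu _ _ _ (cst 1)) => //.
- by apply: measurable_funM; exact: measurable_indic.
- by apply: integrable_cst_lty => //; exact: lebesgue_bounded_itv_lty.
- move=> s _; rewrite !indicE; do 2 case: (_ \in _); rewrite ?(mulr0, mul0r, mulr1, normr0, normr1)//.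
Qed.

Lemma Rintegral_overlap (t u v u' v' : R) : 0 <= u -> 0 <= u' -> v <= t -> v' <= t ->
  \int[mu]_(s in `[0, t[) (\1_(`]u, v]%classic) s * \1_(`]u', v']%classic) s) =
  overlap u v u' v'.
Proof.
move=> u0 u'0 vt v't.
set x := Num.max u u'; set y := Num.min v v'.
have E s : \1_(`]u, v]%classic) s * \1_(`]u', v']%classic) s = \1_(`]x, y]%classic) s :> R.
  rewrite -[LHS]/((\1_(`]u, v]%classic) \* \1_(`]u', v']%classic)) s) -indicI.
  congr (\1_ _ s); apply/seteqP; split=> r /=; rewrite !in_itv/= gt_max le_min.
    by move=> [/andP[-> ->] /andP[-> ->]].
  by move=> /andP[/andP[-> ->] /andP[-> ->]].
under eq_Rintegral do rewrite E.
rewrite Rintegral_itv_bndo_bndc; last first.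
  apply: (@integrable_dominated _ _ _ mu _ _ _ (cst 1)) => //.
    by apply: integrable_cst_lty => //; exact: lebesgue_bounded_itv_lty.
  by move=> s _; rewrite indicE; case: (_ \in _); rewrite ?(normr0, normr1).
rewrite /Rintegral integral_indic// (_ : _ `&` _ = `]x, y]%classic); last first.
  apply/seteqP; split=> [r [] //|r /= rxy]; split=> //.
  move: rxy; rewrite /= !in_itv/= gt_max le_min => /andP[/andP[ur _] /andP[rv _]].
  by rewrite (le_trans u0 (ltW ur)) (le_trans rv vt).
rewrite /= lebesgue_measure_itv/= lte_fin /overlap -/x -/y.
case: ltP => xy /=; first by rewrite max_r// subr_ge0 ltW.
by rewrite max_l// subr_le0.
Qed.

End indicator_overlap.

Section ito_isometry.
Context {disp : measure_display} {Omega : measurableType disp} {R : realType} {d : nat}.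
Variables (P : probability Omega R) (F : R -> set_system Omega).
Variables (W : R -> Omega -> 'cV[R]_d).
Hypotheses (hF : is_filtration F) (hW : is_brownian P F W).
Local Notation mu := (@lebesgue_measure R).
Local Notation kappa := (gauss_second_moment R).

Section scalar.
Variables (j : 'I_d) (t : R) (n : nat) (u v : 'I_n -> R) (a : 'I_n -> Omega -> R).
Hypotheses (u0 : forall k, 0 <= u k) (uv : forall k, u k <= v k) (vt : forall k, v k <= t).
Hypotheses (mwa : forall k, measurable_wrt (F (u k)) (a k)) (ba : forall k, bounded_rv (a k)).

Let ma k : measurable_fun setT (a k).
Proof. exact: (measurable_wrt_measurable hF (u0 k) (mwa k)). Qed.

Let iaa k l : P.-integrable setT (EFin \o (fun w => a k w * a l w)).
Proof.
by apply: bounded_integrable; [exact: measurable_funM|exact: bounded_rvM].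
Qed.

Let iaabb k l : P.-integrable setT (EFin \o (fun w =>
  a k w * a l w * (bincr W j (u k) (v k) w * bincr W j (u l) (v l) w))).
Proof.
apply: (bincr_prod_integrable j hF hW) => //; first exact: measurable_funM.
exact: bounded_rvM.
Qed.

Let sqr_sum (I : finType) (f : I -> R) :
  (\sum_k f k) ^+ 2 = \sum_k \sum_l f k * f l.
Proof. by rewrite expr2 mulr_suml; apply: eq_bigr => k _; rewrite mulr_sumr. Qed.

(** Both sides are the double sum over k and l of the moments of a k * a l
    weighted by the overlap of the intervals k and l: on the left by
    [covariance_bincr], on the right by integrating products of indicators.
    In this way the intervals may overlap and no common partition is needed. *)
Lemma ito_isometry_scalar :
  (\int[P]_w ((\sum_k a k w * bincr W j (u k) (v k) w) ^+ 2)%:E =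
   kappa%:E * \int[P]_w \int[mu]_(s in `[0%R, t[)
     ((\sum_k \1_(`]u k, v k]%classic) s * a k w) ^+ 2)%:E)%E.
Proof.
have lhs : (\int[P]_w ((\sum_k a k w * bincr W j (u k) (v k) w) ^+ 2)%:E =
    (\sum_k \sum_l kappa * overlap (u k) (v k) (u l) (v l) *
      \int[P]_w (a k w * a l w))%:E)%E.
  rewrite -EFin_Rintegral//; last first.
    have -> : (fun w => (\sum_k a k w * bincr W j (u k) (v k) w) ^+ 2) = 
      (fun w => \sum_k \sum_l a k w * a l w *
        (bincr W j (u k) (v k) w * bincr W j (u l) (v l) w)).
      apply/funext => w; rewrite sqr_sum; apply: eq_bigr => k _.
      by apply: eq_bigr => l _; ring.
    apply: integrable_sumR => // k; exact: integrable_sumR.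
  congr EFin.
  transitivity (\int[P]_w (\sum_k \sum_l a k w * a l w *
        (bincr W j (u k) (v k) w * bincr W j (u l) (v l) w))).
    apply: eq_Rintegral => w _; rewrite sqr_sum; apply: eq_bigr => k _.
    by apply: eq_bigr => l _; ring.
  rewrite Rintegral_sum//; last by move=> k; exact: integrable_sumR.
  apply: eq_bigr => k _; rewrite Rintegral_sum//; apply: eq_bigr => l _.
  exact: (covariance_bincr j hF hW).
have inner w : (\int[mu]_(s in `[0%R, t[) ((\sum_k \1_(`]u k, v k]%classic) s * a k w) ^+ 2)%:E =
    (\sum_k \sum_l overlap (u k) (v k) (u l) (v l) * (a k w * a l w))%:E)%E.
  have i k l : mu.-integrable `[0, t[ (EFin \o (fun s => a k w * a l w *
      (\1_(`]u k, v k]%classic) s * \1_(`]u l, v l]%classic) s))).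
    by apply: integrable_scaleR => //; exact: integrable_indic_itv.
  have -> : (fun s => ((\sum_k \1_(`]u k, v k]%classic) s * a k w) ^+ 2)%:E) =
      EFin \o (fun s => (\sum_k \sum_l a k w * a l w *
        (\1_(`]u k, v k]%classic) s * \1_(`]u l, v l]%classic) s))).
    apply/funext => s /=; rewrite sqr_sum; congr EFin; apply: eq_bigr => k _.
    by apply: eq_bigr => l _; ring.
  rewrite -EFin_Rintegral//; last first.
    by apply: integrable_sumR => // k; exact: integrable_sumR.
  congr EFin; rewrite Rintegral_sum//; last by move=> k; exact: integrable_sumR.
  apply: eq_bigr => k _; rewrite Rintegral_sum//; apply: eq_bigr => l _.
  rewrite RintegralZl//; last exact: integrable_indic_itv.
  by rewrite Rintegral_overlap// mulrC.
transitivity (kappa%:E * \int[P]_w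
    (\sum_k \sum_l overlap (u k) (v k) (u l) (v l) * (a k w * a l w))%:E)%E; last first.
  by congr (_ * _)%E; apply: eq_integral => w _; exact/esym/inner.
rewrite lhs -EFin_Rintegral//; last first.
  apply: integrable_sumR => // k; apply: integrable_sumR => // l.
  exact: integrable_scaleR.
rewrite -EFinM; congr EFin.
rewrite Rintegral_sum//; last first.
  by move=> k; apply: integrable_sumR => // l; exact: integrable_scaleR.
rewrite mulr_sumr; apply: eq_bigr => k _.
rewrite Rintegral_sum//; last by move=> l; exact: integrable_scaleR.
rewrite mulr_sumr; apply: eq_bigr => l _.
by rewrite RintegralZl// mulrA.
Qed.

End scalar.

Lemma simple_val_measurable m t (S : simple_process Omega R m d) : is_simple F t S ->
  mx_measurable ((`[0, t[ : set R) `*` setT) (fun p : R * Omega => simple_val S p.1 p.2).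
Proof.
move=> hS; apply: mx_measurable_sum => k i j.
rewrite (_ : (fun p => _) = fun p : R * Omega =>
    \1_(`]sp_left k, sp_right k]%classic) p.1 * sp_coef (s := S) k p.2 i j); last first.
  by apply/funext => p; rewrite mxE.
have [u0 _ _ mc _] := hS k.
have m1 : measurable_fun setT (fun p : R * Omega =>
    \1_(`]sp_left k, sp_right k]%classic) p.1 : R).
  by apply: (measurableT_comp (measurable_indic _) measurable_fst).
have m2 : measurable_fun setT (fun p : R * Omega => sp_coef (s := S) k p.2 i j).
  exact: (measurableT_comp (measurable_wrt_measurable hF u0 (mc i j)) measurable_snd).
by apply: measurable_funTS; exact: measurable_funM.
Qed.

Lemma simple_integral_measurable m t (S : simple_process Omega R m d) : is_simple F t S ->
  mx_measurable setT (simple_integral W S).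
Proof.
move=> hS; apply: mx_measurable_sum => k; have [u0 uv _ mc _] := hS k.
apply: mx_measurableM => i j; first exact: (measurable_wrt_measurable hF u0 (mc i j)).
rewrite (ord1 j); under eq_fun do rewrite !mxE.
exact: (measurable_bincr i hF hW u0 uv).
Qed.

(** Cauchy-Schwarz over the d coordinates of W, at the price of a factor d,
    reduces the inequality to the isometry for one coordinate at a time. *)
Lemma ito_isometry_le m t (S : simple_process Omega R m d) : is_simple F t S ->
  (\int[P]_w (nsq (simple_integral W S w))%:E <=
   (d%:R * kappa)%:E * \int[P]_w \int[mu]_(s in `[0%R, t[) (nsq (simple_val S s w))%:E)%E.
Proof.
move=> hS.
pose x i j w := \sum_k sp_coef (s := S) k w i j * bincr W j (sp_left k) (sp_right k) w.
pose y i j s w := \sum_k \1_(`]sp_left k, sp_right k]%classic) s * sp_coef (s := S) k w i j.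
have mx i j : measurable_fun setT (x i j).
  apply: measurable_sum => k; have [u0 uv _ mc _] := hS k.
  apply: measurable_funM; first exact: (measurable_wrt_measurable hF u0 (mc i j)).
  exact: (measurable_bincr j hF hW u0 uv).
have yE i j s w : simple_val S s w i j = y i j s w.
  by rewrite /simple_val summxE; apply: eq_bigr => k _; rewrite mxE.
have my i j : measurable_fun ((`[0, t[ : set R) `*` setT)
    (fun p : R * Omega => y i j p.1 p.2).
  rewrite (_ : (fun p => _) = fun p : R * Omega => simple_val S p.1 p.2 i j).
    exact: (simple_val_measurable hS).
  by apply/funext => p; rewrite yE.
have msq i j : measurable_fun ((`[0, t[ : set R) `*` setT)
    (fun p : R * Omega => (y i j p.1 p.2 ^+ 2)%:E).
  by apply/measurable_EFinP; exact: measurable_funX.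
have xE i w : simple_integral W S w i 0 = \sum_j x i j w.
  rewrite /simple_integral summxE /x exchange_big/=; apply: eq_bigr => k _.
  by rewrite mxE; apply: eq_bigr => j _; rewrite !mxE.
have xi i j : (\int[P]_w (x i j w ^+ 2)%:E =
    kappa%:E * \int[P]_w \int[mu]_(s in `[0%R, t[) (y i j s w ^+ 2)%:E)%E.
  apply: ito_isometry_scalar => k; have [u0 uv vt mc bc] := hS k => //.
    exact: mc.
  by have [K hK] := bc; exists K => w; exact: le_trans (frob_entry_le _ _ _) (hK w).
apply: (@le_trans _ _ (\int[P]_w (\sum_(i < m) \sum_(j < d) d%:R%:E * (x i j w ^+ 2)%:E))%E).
  apply: ge0_le_integral => //.
  - by move=> w _; rewrite lee_fin nsq_ge0.
  - by apply/measurable_EFinP; apply: measurable_nsq; exact: (simple_integral_measurable hS).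
  - apply: emeasurable_sum => i; apply: emeasurable_sum => j.
    by apply: measurable_funeM; apply/measurable_EFinP; exact: measurable_funX.
  move=> w _; under eq_bigr do under eq_bigr do rewrite -EFinM.
  under eq_bigr do rewrite sumEFin.
  rewrite sumEFin lee_fin; apply: ler_sum => i _.
  rewrite big_ord1 xE (le_trans (sum_sqr_le _))// card_ord mulr_sumr//.
rewrite ge0_integral_sum//; last 2 first.
- move=> i; apply: emeasurable_sum => j.
  by apply: measurable_funeM; apply/measurable_EFinP; exact: measurable_funX.
- by move=> i w _; apply: sume_ge0 => j _; rewrite mule_ge0 ?lee_fin ?sqr_ge0.
have inner w : (\int[mu]_(s in `[0%R, t[) (nsq (simple_val S s w))%:E =
    \sum_(i < m) \sum_(j < d) \int[mu]_(s in `[0%R, t[) (y i j s w ^+ 2)%:E)%E.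
  have myw i j : measurable_fun `[0, t[ (fun s => (y i j s w ^+ 2)%:E).
    apply/measurable_EFinP; apply: measurable_funX; apply: measurable_sum => k.
    by apply: measurable_funM => //; exact: measurable_indic.
  transitivity (\int[mu]_(s in `[0%R, t[) (\sum_(i < m) \sum_(j < d) (y i j s w ^+ 2)%:E))%E.
    apply: eq_integral => s _; rewrite /nsq -sumEFin; apply: eq_bigr => i _.
    by rewrite -sumEFin; apply: eq_bigr => j _; rewrite yE.
  rewrite ge0_integral_sum//; last 2 first.
  - by move=> i; apply: emeasurable_sum => j; exact: myw.
  - by move=> i s _; apply: sume_ge0 => j _; rewrite lee_fin sqr_ge0.
  apply: eq_bigr => i _; apply: ge0_integral_sum => // j; first exact: myw.
  by move=> s _; rewrite lee_fin sqr_ge0.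
have mouter i j : measurable_fun setT
    (fun w => \int[mu]_(s in `[0%R, t[) (y i j s w ^+ 2)%:E)%E.
  apply: (measurable_tonelli_time (f := fun p => (y i j p.1 p.2 ^+ 2)%:E)) => //.
  by move=> p; rewrite lee_fin sqr_ge0.
have outer0 i j w : (0 <= \int[mu]_(s in `[0%R, t[) (y i j s w ^+ 2)%:E)%E.
  by apply: integral_ge0 => s _; rewrite lee_fin sqr_ge0.
rewrite [X in (_ <= _ * X)%E](_ : _ = \int[P]_w (\sum_(i < m) \sum_(j < d)
    \int[mu]_(s in `[0%R, t[) (y i j s w ^+ 2)%:E))%E; last first.
  by apply: eq_integral => w _; exact: inner.
rewrite [X in (_ <= _ * X)%E]ge0_integral_sum//; last 2 first.
- by move=> i; apply: emeasurable_sum => j; exact: mouter.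
- by move=> i w _; exact: sume_ge0.
rewrite ge0_sume_distrr; last first.
  by move=> i _; apply: integral_ge0 => w _; exact: sume_ge0.
apply: lee_sum => i _.
rewrite ge0_integral_sum//; last 2 first.
- by move=> j; apply: measurable_funeM; apply/measurable_EFinP; exact: measurable_funX.
- by move=> j w _; rewrite mule_ge0 ?lee_fin ?sqr_ge0.
rewrite [X in (_ <= _ * X)%E]ge0_integral_sum//.
rewrite ge0_sume_distrr; last by move=> j _; exact: integral_ge0.
apply: lee_sum => j _; rewrite ge0_integralZl//; last 2 first.
- by apply/measurable_EFinP; exact: measurable_funX.
- by move=> w _; rewrite lee_fin sqr_ge0.
by rewrite xi EFinM muleA.
Qed.

End ito_isometry.

(** * The Ito isometry inequality *)

Section integral_comparison.
Local Open Scope ereal_scope.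

Lemma ge0_le_integral_lin3 {d : measure_display} {T : measurableType d} {R : realType}
    (mu : {measure set T -> \bar R}) (D : set T) (f g h k : T -> \bar R) (a b c : R) :
  measurable D ->
  measurable_fun D f -> measurable_fun D g -> measurable_fun D h -> measurable_fun D k ->
  (forall x, D x -> 0 <= f x) -> (forall x, D x -> 0 <= g x) ->
  (forall x, D x -> 0 <= h x) -> (forall x, D x -> 0 <= k x) ->
  (0 <= a)%R -> (0 <= b)%R -> (0 <= c)%R ->
  (forall x, D x -> f x <= a%:E * g x + b%:E * h x + c%:E * k x) ->
  \int[mu]_(x in D) f x <= a%:E * \int[mu]_(x in D) g x +
    b%:E * \int[mu]_(x in D) h x + c%:E * \int[mu]_(x in D) k x.
Proof.
move=> mD mf mg mh mk f0 g0 h0 k0 a0 b0 c0 fghk.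
have a0' : 0 <= a%:E by rewrite lee_fin.
have b0' : 0 <= b%:E by rewrite lee_fin.
have c0' : 0 <= c%:E by rewrite lee_fin.
have mag := measurable_funeM a%:E mg.
have mbh := measurable_funeM b%:E mh.
have mck := measurable_funeM c%:E mk.
have magbh := emeasurable_funD mag mbh.
apply: (@le_trans _ _ (\int[mu]_(x in D) (a%:E * g x + b%:E * h x + c%:E * k x))).
  by apply: ge0_le_integral => //; exact: emeasurable_funD.
rewrite ge0_integralD//; last 2 first.
- by move=> x Dx; rewrite adde_ge0 ?mule_ge0 ?g0 ?h0.
- by move=> x Dx; rewrite mule_ge0 ?k0.
rewrite ge0_integralD//; last 2 first.
- by move=> x Dx; rewrite mule_ge0 ?g0.
- by move=> x Dx; rewrite mule_ge0 ?h0.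
by rewrite !ge0_integralZl.
Qed.

Context {disp : measure_display} {Omega : measurableType disp} {R : realType}.
Variable P : probability Omega R.
Local Notation mu := (@lebesgue_measure R).

Lemma ge0_le_integral2_lin3 (D : set R) (f g h k : R -> Omega -> R) (a b c : R) :
  measurable D ->
  measurable_fun (D `*` setT) (fun p : R * Omega => f p.1 p.2) ->
  measurable_fun (D `*` setT) (fun p : R * Omega => g p.1 p.2) ->
  measurable_fun (D `*` setT) (fun p : R * Omega => h p.1 p.2) ->
  measurable_fun (D `*` setT) (fun p : R * Omega => k p.1 p.2) ->
  (forall s w, 0 <= f s w)%R -> (forall s w, 0 <= g s w)%R ->
  (forall s w, 0 <= h s w)%R -> (forall s w, 0 <= k s w)%R ->
  (0 <= a)%R -> (0 <= b)%R -> (0 <= c)%R ->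
  (forall s w, D s -> f s w <= a * g s w + b * h s w + c * k s w)%R ->
  \int[P]_w \int[mu]_(s in D) (f s w)%:E <=
    a%:E * (\int[P]_w \int[mu]_(s in D) (g s w)%:E) +
    b%:E * (\int[P]_w \int[mu]_(s in D) (h s w)%:E) +
    c%:E * (\int[P]_w \int[mu]_(s in D) (k s w)%:E).
Proof.
move=> mD mf mg mh mk f0 g0 h0 k0 a0 b0 c0 fghk.
have mouter (x : R -> Omega -> R) : (forall s w, 0 <= x s w)%R ->
    measurable_fun (D `*` setT) (fun p : R * Omega => x p.1 p.2) ->
    measurable_fun setT (fun w => \int[mu]_(s in D) (x s w)%:E).
  move=> x0 mx; apply: (measurable_tonelli_time (f := fun p => (x p.1 p.2)%:E)) => //.
    exact/measurable_EFinP.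
  by move=> p; rewrite lee_fin.
have msection (x : R -> Omega -> R) w :
    measurable_fun (D `*` setT) (fun p : R * Omega => x p.1 p.2) ->
    measurable_fun D (fun s => (x s w)%:E).
  move=> mx; apply/measurable_EFinP.
  apply: (@measurable_comp _ _ _ _ _ _ (D `*` setT) (fun p : R * Omega => x p.1 p.2) D
     (fun s => (s, w))) => //.
  - exact: measurableX.
  - by move=> _ [s Ds <-].
  - by apply: measurable_funTS; exact: pair2_measurable.
have i0 : forall (x : R -> Omega -> R) w, (forall s w, 0 <= x s w)%R ->
    0 <= \int[mu]_(s in D) (x s w)%:E.
  by move=> x w x0; apply: integral_ge0 => s _; rewrite lee_fin.
have [mf' mg' mh' mk'] := And4 (mouter f f0 mf) (mouter g g0 mg) (mouter h h0 mh) (mouter k k0 mk).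
apply: ge0_le_integral_lin3 => //; [by move=> w _; exact: i0..|].
move=> w _.
have [mfw mgw mhw mkw] := And4 (msection f w mf) (msection g w mg) (msection h w mh) (msection k w mk).
apply: ge0_le_integral_lin3 => //; [by move=> s _; rewrite lee_fin..|].
by move=> s Ds; rewrite -!EFinM -!EFinD lee_fin fghk.
Qed.

Lemma ge0_le_integral2_lin2 (D : set R) (f g h : R -> Omega -> R) (a b : R) :
  measurable D ->
  measurable_fun (D `*` setT) (fun p : R * Omega => f p.1 p.2) ->
  measurable_fun (D `*` setT) (fun p : R * Omega => g p.1 p.2) ->
  measurable_fun (D `*` setT) (fun p : R * Omega => h p.1 p.2) ->
  (forall s w, 0 <= f s w)%R -> (forall s w, 0 <= g s w)%R ->
  (forall s w, 0 <= h s w)%R -> (0 <= a)%R -> (0 <= b)%R ->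
  (forall s w, D s -> f s w <= a * g s w + b * h s w)%R ->
  \int[P]_w \int[mu]_(s in D) (f s w)%:E <=
    a%:E * (\int[P]_w \int[mu]_(s in D) (g s w)%:E) +
    b%:E * (\int[P]_w \int[mu]_(s in D) (h s w)%:E).
Proof.
move=> mD mf mg mh f0 g0 h0 a0 b0 fgh.
have := @ge0_le_integral2_lin3 D f g h h a b 0%R mD mf mg mh mh f0 g0 h0 h0 a0 b0 (lexx _).
rewrite mul0e adde0; apply => s w Ds.
by rewrite mul0r addr0 fgh.
Qed.

Lemma ge0_le_integral2 (D : set R) (f g : R -> Omega -> R) :
  measurable D ->
  measurable_fun (D `*` setT) (fun p : R * Omega => f p.1 p.2) ->
  measurable_fun (D `*` setT) (fun p : R * Omega => g p.1 p.2) ->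
  (forall s w, 0 <= f s w)%R -> (forall s w, 0 <= g s w)%R ->
  (forall s w, D s -> f s w <= g s w)%R ->
  \int[P]_w \int[mu]_(s in D) (f s w)%:E <= \int[P]_w \int[mu]_(s in D) (g s w)%:E.
Proof.
move=> mD mf mg f0 g0 fg.
have := @ge0_le_integral2_lin2 D f g g 1%R 0%R mD mf mg mg f0 g0 g0 ler01 (lexx _).
rewrite mul0e adde0 mul1e; apply => s w Ds.
by rewrite mul0r addr0 mul1r fg.
Qed.

Lemma lee_vanishing_error (x y : \bar R) (u : nat -> \bar R) :
  u n @[n --> \oo] --> 0 -> (forall n, x <= y + u n) -> x <= y.
Proof.
move=> cu xyu.
have cy : y + u n @[n --> \oo] --> y.
  rewrite -[X in _ --> X]adde0; apply: cvgeD => //; last exact: cvg_cst.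
  by rewrite fin_num_adde_defl.
rewrite -(cvg_lim _ cy)//; apply: lime_ge; first by apply/cvg_ex; exists y.
exact: nearW.
Qed.

Lemma vanishing_error_lin (c k : R) (a a' b b' : nat -> \bar R) :
  a n @[n --> \oo] --> 0 -> a' n @[n --> \oo] --> 0 ->
  b n @[n --> \oo] --> 0 -> b' n @[n --> \oo] --> 0 ->
  c%:E * (a n + a' n) + k%:E * (b n + b' n) @[n --> \oo] --> 0.
Proof.
move=> ca ca' cb cb'.
have -> : 0 = c%:E * (0 + 0) + k%:E * (0 + 0) :> \bar R.
  by rewrite !adde0 !mule0 adde0.
apply: cvgeD; first by rewrite !adde0 !mule0.
  by apply: cvgeZl => //; apply: cvgeD.
by apply: cvgeZl => //; apply: cvgeD.
Qed.

End integral_comparison.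

Section simple_process_difference.
Context {Omega : Type} {R : realType} {m d : nat}.
Implicit Types S : simple_process Omega R m d.

(** Simple processes are finite families of weighted intervals, so a difference
    is a concatenation. *)
Definition simple_sub S S' : simple_process Omega R m d :=
  @SimpleProcess Omega R m d (sp_size S + sp_size S')
    (fun k => match fintype.split k with inl i => sp_left i | inr i => sp_left i end)
    (fun k => match fintype.split k with inl i => sp_right i | inr i => sp_right i end)
    (fun k => match fintype.split k with
              | inl i => sp_coef i | inr i => fun w => - sp_coef i w end).

Let split_lshiftE a b (i : 'I_a) : fintype.split (lshift b i) = inl i.
Proof. exact: (unsplitK (inl i)). Qed.

Let split_rshiftE a b (i : 'I_b) : fintype.split (rshift a i) = inr i.
Proof. exact: (unsplitK (inr i)). Qed.

Lemma simple_val_sub S S' s w :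
  simple_val (simple_sub S S') s w = simple_val S s w - simple_val S' s w.
Proof.
rewrite /simple_val/= big_split_ord/= -sumrN; congr (_ + _); apply: eq_bigr => i _.
  by rewrite !split_lshiftE.
by rewrite !split_rshiftE scalerN.
Qed.

Lemma simple_integral_sub (W : R -> Omega -> 'cV[R]_d) S S' w :
  simple_integral W (simple_sub S S') w = simple_integral W S w - simple_integral W S' w.
Proof.
rewrite /simple_integral/= big_split_ord/= -sumrN; congr (_ + _); apply: eq_bigr => i _.
  by rewrite !split_lshiftE.
by rewrite !split_rshiftE mulNmx.
Qed.

Lemma is_simple_sub (F : R -> set_system Omega) (t : R) S S' :
  is_simple F t S -> is_simple F t S' -> is_simple F t (simple_sub S S').
Proof.
move=> hS hS' k; rewrite /simple_sub/=; case: (fintype.split k) => i.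
  exact: hS.
have [u0 uv vt mc [K bc]] := hS' i; split=> //.
  move=> a b B mB; have mB' : measurable (-%R @^-1` B).
    by rewrite -[X in measurable X]setTI; exact: oppr_measurable.
  rewrite (_ : _ @^-1` B = (fun w => sp_coef i w a b) @^-1` (-%R @^-1` B)); first exact: mc.
  by apply/seteqP; split=> w /=; rewrite mxE.
by exists K => w; rewrite frobE nsqN; exact: bc.
Qed.

End simple_process_difference.

Section ito_integral_bound.
Context {disp : measure_display} {Omega : measurableType disp} {R : realType} {d : nat}.
Variables (P : probability Omega R) (F : R -> set_system Omega).
Variables (W : R -> Omega -> 'cV[R]_d).
Hypotheses (hF : is_filtration F) (hW : is_brownian P F W).
Local Notation mu := (@lebesgue_measure R).
Local Notation kappa := (gauss_second_moment R).
Local Open Scope ereal_scope.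

(** The arithmetic of the two triangle inequalities below, on abstract
    extended reals. *)
Let triangle_constants (c : R) (x E a a' b b' : \bar R) : (0 <= c)%R ->
  0 <= E -> 0 <= a -> 0 <= a' -> 0 <= b -> 0 <= b' ->
  x <= 2%:E * E + 4%:E * a' + 4%:E * a ->
  2%:E * (c%:E * x) + 4%:E * b' + 4%:E * b <=
  (4 * c)%:E * E + ((8 * c)%:E * (a' + a) + 4%:E * (b' + b)).
Proof.
move=> c0 E0 a0 a'0 b0 b'0 xE.
rewrite [4%:E * (b' + b)]ge0_muleDr// !addeA; do 2 apply: leeD2r.
rewrite muleA -EFinM.
apply: (@le_trans _ _ ((2 * c)%:E * (2%:E * E + 4%:E * a' + 4%:E * a))).
  by apply: lee_wpmul2l => //; rewrite lee_fin mulr_ge0.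
rewrite !ge0_muleDr ?adde_ge0 ?mule_ge0 ?lee_fin// !muleA -!EFinM addeA.
have -> : (2 * c * 2 = 4 * c)%R by ring.
by have -> : (2 * c * 4 = 8 * c)%R by ring.
Qed.

(** The isometry for the simple processes approximating H' - H passes to the
    limit: two applications of |a + b| ^ 2 <= 2 |a| ^ 2 + 2 |b| ^ 2 on each
    side put the approximation errors into a term that tends to 0. *)
Lemma ito_integral_sub_le m t (H H' : R -> Omega -> 'M[R]_(m, d)) (I I' : Omega -> 'cV[R]_m) :
  is_ito_integral P F W t H I -> is_ito_integral P F W t H' I' ->
  \int[P]_w (nsq (I' w - I w))%:E <=
  (4 * (d%:R * kappa))%:E * \int[P]_w \int[mu]_(s in `[0%R, t[) (nsq (H' s w - H s w))%:E.
Proof.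
move=> [[mH _ _] mI [S [hS HS IS]]] [[mH' _ _] mI' [S' [hS' HS' IS']]].
pose A n := \int[P]_w \int[mu]_(s in `[0%R, t[) (nsq (H s w - simple_val (S n) s w))%:E.
pose A' n := \int[P]_w \int[mu]_(s in `[0%R, t[) (nsq (H' s w - simple_val (S' n) s w))%:E.
pose B n := \int[P]_w (nsq (I w - simple_integral W (S n) w))%:E.
pose B' n := \int[P]_w (nsq (I' w - simple_integral W (S' n) w))%:E.
have cA : A n @[n --> \oo] --> 0.
  apply: cvg_trans HS; apply: near_eq_cvg; apply: nearW => n; rewrite /A.
  by apply: eq_integral => w _; apply: eq_integral => s _; rewrite frob_sqr.
have cA' : A' n @[n --> \oo] --> 0.
  apply: cvg_trans HS'; apply: near_eq_cvg; apply: nearW => n; rewrite /A'.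
  by apply: eq_integral => w _; apply: eq_integral => s _; rewrite frob_sqr.
have cB : B n @[n --> \oo] --> 0.
  apply: cvg_trans IS; apply: near_eq_cvg; apply: nearW => n.
  by rewrite /B unlock; apply: eq_integral => w _; rewrite frob_sqr.
have cB' : B' n @[n --> \oo] --> 0.
  apply: cvg_trans IS'; apply: near_eq_cvg; apply: nearW => n.
  by rewrite /B' unlock; apply: eq_integral => w _; rewrite frob_sqr.
set E := \int[P]_w \int[mu]_(s in `[0%R, t[) (nsq (H' s w - H s w))%:E.
have E0 : 0 <= E.
  by apply: integral_ge0 => w _; apply: integral_ge0 => s _; rewrite lee_fin nsq_ge0.
have dk0 : (0 <= d%:R * kappa)%R by rewrite mulr_ge0// gauss_second_moment_ge0.
have dk4 : (0 <= 4 * (d%:R * kappa))%R by rewrite mulr_ge0.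
pose X n := \int[P]_w \int[mu]_(s in `[0%R, t[)
  (nsq (simple_val (S' n) s w - simple_val (S n) s w))%:E.
have step1 n : \int[P]_w (nsq (I' w - I w))%:E <=
    2%:E * ((d%:R * kappa)%:E * X n) + 4%:E * B' n + 4%:E * B n.
  have mIS := simple_integral_measurable hF hW (hS n).
  have mIS' := simple_integral_measurable hF hW (hS' n).
  have : \int[P]_w (nsq (I' w - I w))%:E <=
    2%:E * (\int[P]_w (nsq (simple_integral W (S' n) w - simple_integral W (S n) w))%:E)
     + 4%:E * B' n + 4%:E * B n.
    apply: ge0_le_integral_lin3 => //; try by move=> w _; rewrite lee_fin nsq_ge0.
    - by apply/measurable_EFinP; apply: measurable_nsq; exact: mx_measurableB.
    - by apply/measurable_EFinP; apply: measurable_nsq; exact: mx_measurableB.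
    - by apply/measurable_EFinP; apply: measurable_nsq; exact: mx_measurableB.
    - by apply/measurable_EFinP; apply: measurable_nsq; exact: mx_measurableB.
    - move=> w _; rewrite -!EFinM -!EFinD lee_fin.
      set a := simple_integral W _ w; set b := simple_integral W _ w.
      have -> : (I' w - I w = (a - b) + ((I' w - a) - (I w - b)))%R.
        by rewrite opprB addrACA [(a + _)%R]addrC subrK addKr.
      have h1 := nsqD_le (a - b) ((I' w - a) - (I w - b)).
      have h2 := nsqB_le (I' w - a) (I w - b).
      lra.
  move=> /le_trans; apply; rewrite !leeD2r// lee_wpmul2l//.
  have := ito_isometry_le hF hW (is_simple_sub (hS' n) (hS n)).
  rewrite (_ : \int[P]_w (nsq (simple_integral _ _ _))%:E =
    \int[P]_w (nsq (simple_integral W (S' n) w - simple_integral W (S n) w))%:E); last first.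
    by apply: eq_integral => w _; rewrite simple_integral_sub.
  move=> /le_trans; apply; apply: lee_wpmul2l; first by rewrite lee_fin.
  rewrite /X.
  rewrite le_eqVlt; apply/orP; left; apply/eqP.
  by apply: eq_integral => w _; apply: eq_integral => s _; rewrite simple_val_sub.
have step2 n : X n <= 2%:E * E + 4%:E * A' n + 4%:E * A n.
  have mS := simple_val_measurable hF (hS n).
  have mS' := simple_val_measurable hF (hS' n).
  apply: ge0_le_integral2_lin3 => //; try by move=> s w; exact: nsq_ge0.
  - by apply: measurable_nsq; exact: mx_measurableB.
  - by apply: measurable_nsq; exact: mx_measurableB.
  - by apply: measurable_nsq; exact: mx_measurableB.
  - by apply: measurable_nsq; exact: mx_measurableB.
  - move=> s w _; set a := simple_val _ s w; set b := simple_val _ s w.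
    have -> : (a - b = (H' s w - H s w) + ((a - H' s w) - (b - H s w)))%R.
      by rewrite opprB addrACA [(H' s w + _)%R]addrC subrK addKr.
    have h1 := nsqD_le (H' s w - H s w) ((a - H' s w) - (b - H s w)).
    have := nsqB_le (a - H' s w) (b - H s w).
    by rewrite (nsqBC a) (nsqBC b); lra.
pose e n := (8 * (d%:R * kappa))%:E * (A' n + A n) + 4%:E * (B' n + B n).
have step3 n : \int[P]_w (nsq (I' w - I w))%:E <= (4 * (d%:R * kappa))%:E * E + e n.
  have A0 : 0 <= A n.
    by apply: integral_ge0 => w _; apply: integral_ge0 => s _; rewrite lee_fin nsq_ge0.
  have A'0 : 0 <= A' n.
    by apply: integral_ge0 => w _; apply: integral_ge0 => s _; rewrite lee_fin nsq_ge0.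
  have B0 : 0 <= B n by apply: integral_ge0 => w _; rewrite lee_fin nsq_ge0.
  have B'0 : 0 <= B' n by apply: integral_ge0 => w _; rewrite lee_fin nsq_ge0.
  exact: (le_trans (step1 n) (triangle_constants dk0 E0 A0 A'0 B0 B'0 (step2 n))).
have ce : e n @[n --> \oo] --> 0 by exact: (vanishing_error_lin _ _ cA' cA cB' cB).
exact: (lee_vanishing_error ce step3).
Qed.

End ito_integral_bound.

(** * Second moments of the difference of two solutions *)

Section drift_cauchy_schwarz.
Context {R : realType}.
Local Notation mu := (@lebesgue_measure R).

(** The integral of (f - c) ^ 2 is nonnegative for c the mean of f. *)
Lemma Rintegral_sqr_le (t : R) (f : R -> R) : 0 <= t ->
  mu.-integrable `[0, t[ (EFin \o f) -> mu.-integrable `[0, t[ (EFin \o (fun s => f s ^+ 2)) ->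
  (\int[mu]_(s in `[0, t[) f s) ^+ 2 <= t * \int[mu]_(s in `[0, t[) (f s ^+ 2).
Proof.
rewrite le_eqVlt => /predU1P[<- _ _|t0 fi f2i].
  by rewrite set_itvco0 !Rintegral_set0 expr0n mul0r.
set m := \int[mu]_(s in `[0, t[) f s; pose c := m / t.
have ci : mu.-integrable `[0, t[ (EFin \o cst (c ^+ 2)).
  by apply: integrable_cst_lty => //; exact: lebesgue_bounded_itv_lty.
have fci : mu.-integrable `[0, t[ (EFin \o (fun s => - (2 * c) * f s)).
  by apply: integrable_scaleR.
have : 0 <= \int[mu]_(s in `[0, t[) (f s ^+ 2 + (- (2 * c) * f s + cst (c ^+ 2) s)).
  apply: Rintegral_ge0 => s _ /=.
  by have := sqr_ge0 (f s - c); nra.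
rewrite RintegralD//; last by apply: integrable_addR.
rewrite RintegralD// RintegralZl// Rintegral_cst//.
rewrite -/m /= lebesgue_measure_itv/= lte_fin t0 sube0 /= /c => h.
have {}h : 0 <= t * (\int[mu]_(s in `[0, t[) (f s ^+ 2) + (- (2 * (m / t)) * m + (m / t) ^+ 2 * t)).
  by rewrite mulr_ge0// ltW.
rewrite -subr_ge0 (le_trans h)// le_eqVlt; apply/orP; left; apply/eqP.
by field; rewrite gt_eqF.
Qed.

Lemma integrable_of_sqr (t : R) (f : R -> R) : measurable_fun `[0, t[ f ->
  mu.-integrable `[0, t[ (EFin \o (fun s => f s ^+ 2)) -> mu.-integrable `[0, t[ (EFin \o f).
Proof.
move=> mf f2i; apply: (@integrable_dominated _ _ _ mu _ _ f (fun s => cst 1 s + f s ^+ 2)) => //.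
  apply: integrable_addR => //; apply: integrable_cst_lty => //.
  exact: lebesgue_bounded_itv_lty.
move=> s _ /=; rewrite -(real_normK (num_real (f s))).
have := sqr_ge0 (`|f s| - 1); have := normr_ge0 (f s); nra.
Qed.

(** The finiteness hypotheses make the integrals of h and h' genuine, so that
    their difference is the integral of the difference. *)
Lemma drift_difference_le d (t : R) (h h' : R -> 'cV[R]_d) : 0 <= t ->
  mx_measurable `[0, t[ h -> mx_measurable `[0, t[ h' ->
  (\int[mu]_(s in `[0%R, t[) (nsq (h s))%:E < +oo)%E ->
  (\int[mu]_(s in `[0%R, t[) (nsq (h' s))%:E < +oo)%E ->
  ((nsq ((\col_i \int[mu]_(s in `[0, t[) (h' s i 0)) - (\col_i \int[mu]_(s in `[0, t[) (h s i 0)) : 'cV[R]_d))%:E <=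
   t%:E * \int[mu]_(s in `[0%R, t[) (nsq (h' s - h s))%:E)%E.
Proof.
move=> t0 mh mh' hfin h'fin.
have nsq_int (g : R -> 'cV[R]_d) : mx_measurable `[0, t[ g ->
    (\int[mu]_(s in `[0%R, t[) (nsq (g s))%:E < +oo)%E ->
    mu.-integrable `[0, t[ (EFin \o (fun s => nsq (g s))).
  move=> mg gfin; apply/integrableP; split.
    by apply/measurable_EFinP; exact: measurable_nsq.
  by under eq_integral do rewrite /= ger0_norm ?nsq_ge0//.
have sqr_int (g : R -> 'cV[R]_d) i : mx_measurable `[0, t[ g ->
    mu.-integrable `[0, t[ (EFin \o (fun s => nsq (g s))) ->
    mu.-integrable `[0, t[ (EFin \o (fun s => g s i 0 ^+ 2)).
  move=> mg ig; apply: (@integrable_dominated _ _ _ mu _ _ _ (fun s => nsq (g s))) => //.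
    by apply: measurable_funX; exact: mg.
  by move=> s _; rewrite ger0_norm ?sqr_ge0// nsq_entry_le.
have ih := nsq_int h mh hfin; have ih' := nsq_int h' mh' h'fin.
have mhh' := mx_measurableB mh' mh.
have ihh' : mu.-integrable `[0, t[ (EFin \o (fun s => nsq (h' s - h s))).
  apply: (@integrable_dominated _ _ _ mu _ _ _ (fun s => 2 * nsq (h' s) + 2 * nsq (h s))) => //.
  - exact: measurable_nsq.
  - by apply: integrable_addR => //; exact: integrable_scaleR.
  - by move=> s _; rewrite ger0_norm ?nsq_ge0// nsqB_le.
have lin (g : R -> 'cV[R]_d) i (mg : mx_measurable `[0, t[ g)
    (ig : mu.-integrable `[0, t[ (EFin \o (fun s => nsq (g s)))) :=
  integrable_of_sqr (mg i 0) (sqr_int g i mg ig).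
rewrite -EFin_Rintegral// -EFinM lee_fin.
have -> : \int[mu]_(s in `[0, t[) nsq (h' s - h s) =
    \int[mu]_(s in `[0, t[) (\sum_i ((h' s - h s) i 0 ^+ 2)).
  by apply: eq_Rintegral => s _; apply: eq_bigr => i _; rewrite big_ord1.
rewrite Rintegral_sum//; last by move=> i; exact: (sqr_int (fun s => h' s - h s) i mhh').
rewrite mulr_sumr /nsq; apply: ler_sum => i _; rewrite big_ord1 !mxE.
rewrite -RintegralB//; [|exact: (lin h' i mh' ih')|exact: (lin h i mh ih)].
rewrite (le_trans _ (Rintegral_sqr_le t0 _ (sqr_int (fun s => h' s - h s) i mhh' ihh')))//.
  rewrite le_eqVlt; apply/orP; left; apply/eqP; congr (_ ^+ 2).
  by apply: eq_Rintegral => s _; rewrite !mxE.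
exact: (lin (fun s => h' s - h s) i mhh' ihh').
Qed.

End drift_cauchy_schwarz.

Section stability.
Context {disp : measure_display} {Omega : measurableType disp} {R : realType} {d : nat}.
Variables (P : probability Omega R) (F : R -> set_system Omega).
Variables (W : R -> Omega -> 'cV[R]_d).
Hypotheses (hF : is_filtration F) (hW : is_brownian P F W).
Variables (T : R).
Local Notation mu := (@lebesgue_measure R).
Local Notation kappa := (gauss_second_moment R).

Lemma measurable_kernel (k : R -> R) (t : R) : t <= T ->
  measurable_fun (`]0, T] : set R) k ->
  measurable_fun (`[0, t[ : set R) (fun s => k (t - s)).
Proof.
move=> tT mk; apply: (@measurable_comp _ _ _ R R R `]0, T]%classic k `[0, t[%classic (fun s : R => t - s)) => //.
  by move=> _ [s /= + <-]; rewrite !in_itv/=; lra.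
by apply: measurable_funTS; exact: measurable_reflect.
Qed.

Lemma measurable_fun_fst (D : set R) (f : R -> R) : measurable D ->
  measurable_fun D f -> measurable_fun (D `*` [set: Omega]) (fun p : R * Omega => f p.1).
Proof.
move=> mD mf; apply: (@measurable_comp _ _ _ _ _ _ D f _ fst) => //.
- by move=> _ [[s w] [/= Ds _] <-].
- by apply: measurable_funTS; exact: measurable_fst.
Qed.

Lemma mx_measurable_kernel m n (k : R -> 'M[R]_(m, n)) (t : R) : t <= T ->
  mx_measurable (`]0, T] : set R) k ->
  mx_measurable ((`[0, t[ : set R) `*` [set: Omega]) (fun p : R * Omega => k (t - p.1)).
Proof.
move=> tT mk i j; apply: (@measurable_fun_fst _ (fun s => k (t - s) i j)) => //.
exact: (measurable_kernel tT (mk i j)).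
Qed.

Lemma mx_measurable_before m n (X : R -> Omega -> 'M[R]_(m, n)) t : t <= T ->
  mx_measurable ((`[0, T] : set R) `*` [set: Omega]) (fun p : R * Omega => X p.1 p.2) ->
  mx_measurable ((`[0, t[ : set R) `*` [set: Omega]) (fun p : R * Omega => X p.1 p.2).
Proof.
move=> tT mX i j; apply: measurable_funS (mX i j).
  exact: measurableX.
move=> [s w] [/= + _]; rewrite !in_itv/= => /andP[s0 st]; split=> //=.
by rewrite s0/= (le_trans (ltW st)).
Qed.

Lemma mx_measurable_section m n D (X : R -> Omega -> 'M[R]_(m, n)) w : measurable D ->
  mx_measurable (D `*` [set: Omega]) (fun p : R * Omega => X p.1 p.2) ->
  mx_measurable D (fun s => X s w).
Proof.
move=> mD mX i j.
apply: (@measurable_comp _ _ _ _ _ _ (D `*` setT) (fun p : R * Omega => X p.1 p.2 i j) D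
     (fun s => (s, w))) => //.
- exact: measurableX.
- by move=> _ [s Ds <-].
- by apply: measurable_funTS; exact: pair2_measurable.
Qed.

Lemma tonelli_convolution (k : R -> R) (Y : R -> Omega -> R) (t : R) : t <= T ->
  measurable_fun (`]0, T] : set R) k -> (forall s, 0 <= k s) ->
  measurable_fun ((`[0, t[ : set R) `*` [set: Omega]) (fun p : R * Omega => Y p.1 p.2) ->
  (forall s w, 0 <= Y s w) ->
  (\int[P]_w \int[mu]_(s in `[0%R, t[) (k (t - s) * Y s w)%:E =
   \int[mu]_(s in `[0%R, t[) ((k (t - s))%:E * \int[P]_w (Y s w)%:E))%E.
Proof.
move=> tT mk k0 mY Y0.
rewrite (@tonelli_restricted _ _ _ P _ (fun p => (k (t - p.1) * Y p.1 p.2)%:E))//.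
- apply: eq_integral => s; rewrite inE => st; rewrite -ge0_integralZl//.
  + apply/measurable_EFinP => /=.
    apply: (@measurable_comp _ _ _ _ _ _ ((`[0, t[ : set R) `*` setT)
      (fun p : R * Omega => Y p.1 p.2) _ (fun w => (s, w))) => //.
    * exact: measurableX.
    * by move=> _ [w _ <-].
    * exact: pair1_measurable.
  + by move=> w _; rewrite lee_fin.
  + by rewrite lee_fin.
- apply/measurable_EFinP; apply: measurable_funM; last exact: mY.
  by apply: (@measurable_fun_fst _ (fun s => k (t - s))) => //; exact: measurable_kernel.
- by move=> p; rewrite lee_fin mulr_ge0.
Qed.

(** After Tonelli the moment of Y factors out of the convolution. *)
Lemma convolution_moment_le (k : R -> R) (Y : R -> Omega -> R) (t M : R) : t <= T ->
  measurable_fun (`]0, T] : set R) k -> (forall s, 0 <= k s) ->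
  measurable_fun ((`[0, t[ : set R) `*` [set: Omega]) (fun p : R * Omega => Y p.1 p.2) ->
  (forall s w, 0 <= Y s w) -> 0 <= M ->
  (forall s, 0 <= s -> s < t -> (\int[P]_w (Y s w)%:E <= M%:E)%E) ->
  (\int[P]_w \int[mu]_(s in `[0%R, t[) (k (t - s) * Y s w)%:E <=
   M%:E * \int[mu]_(s in `]0%R, t]) (k s)%:E)%E.
Proof.
move=> tT mk k0 mY Y0 M0 YM.
have mkt : measurable_fun (`]0, t] : set R) (fun s => (k s)%:E).
  apply/measurable_EFinP; apply: measurable_funS mk => // s /=.
  by rewrite !in_itv/= => /andP[-> st]; exact: le_trans tT.
have mkr : measurable_fun `[0, t[ (fun s => (k (t - s))%:E).
  by apply/measurable_EFinP; exact: (measurable_kernel tT mk).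
rewrite (tonelli_convolution tT mk k0 mY Y0).
apply: (@le_trans _ _ (\int[mu]_(s in `[0%R, t[) (M%:E * (k (t - s))%:E))%E).
  apply: ge0_le_integral => //.
  - by move=> s _; rewrite mule_ge0 ?lee_fin// integral_ge0// => w _; rewrite lee_fin.
  - apply: emeasurable_funM => //.
    apply: (@measurable_tonelli_space _ _ _ P _ (fun p => (Y p.1 p.2)%:E)) => //.
    + exact/measurable_EFinP.
    + by move=> p; rewrite lee_fin.
  - exact: measurable_funeM.
  - move=> s /=; rewrite in_itv/= => /andP[s0 st].
    by rewrite muleC lee_wpmul2r ?lee_fin// YM.
rewrite ge0_integralZl//; last by move=> s _; rewrite lee_fin.
rewrite (@integral_convolution_reflect _ _ (fun s => (k s)%:E))// => s _.
by rewrite lee_fin.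
Qed.

Lemma measurable_solution_at (m n : nat) (X : R -> Omega -> 'M[R]_(m, n)) t : 0 <= t ->
  mx_measurable_wrt (F t) (X t) -> mx_measurable setT (X t).
Proof. by move=> t0 mX i j; exact: (measurable_wrt_measurable hF t0 (mX i j)). Qed.

Lemma integral_add1_le (X : Omega -> 'cV[R]_d) (M : R) : mx_measurable setT X ->
  (\int[P]_w (nsq (X w))%:E <= M%:E)%E ->
  (\int[P]_w (1 + nsq (X w))%:E <= (1 + M)%:E)%E.
Proof.
move=> mX XM.
rewrite -[leLHS]/(\int[P]_w (1%:E + (nsq (X w))%:E))%E.
rewrite ge0_integralD//; last 2 first.
- by move=> w _; rewrite lee_fin nsq_ge0.
- by apply/measurable_EFinP; exact: measurable_nsq.
rewrite integral_cst//= mul1e (_ : P [set: Omega] = 1%E); last exact: probability_setT.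
by rewrite EFinD leeD2l.
Qed.

Variables (x0 : 'cV[R]_d) (b : 'cV[R]_d -> 'cV[R]_d) (sigma : 'cV[R]_d -> 'M[R]_d) (L : R).
Hypothesis L0 : 0 < L.
Hypothesis b_lip : forall x y, nsq (b x - b y) <= L * nsq (x - y).
Hypothesis sigma_lip : forall x y, nsq (sigma x - sigma y) <= L * nsq (x - y).
Hypothesis b_growth : forall x, nsq (b x) <= L * (1 + nsq x).

(** The bound depends on the solution; it serves for qualitative purposes only,
    to know that integrals are finite. *)
Lemma moment_bound (k1 k2 : R -> 'M[R]_d) X :
  is_volterra_solution P F W T x0 b sigma k1 k2 X ->
  exists2 M : R, 0 <= M & forall t, 0 <= t <= T -> (\int[P]_w (nsq (X t w))%:E <= M%:E)%E.
Proof.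
move=> hX; have := solution_moment hX; set E := ereal_sup _ => Efin.
have E_ub t : 0 <= t <= T -> (\int[P]_w (nsq (X t w))%:E <= E)%E.
  move=> tT; apply: ereal_sup_ubound; exists t => //.
  by rewrite unlock; apply: eq_integral => w _; rewrite frob_sqr.
exists (Num.max 0 (fine E)); first by rewrite le_max lexx.
move=> t tT; have Et := E_ub t tT.
have E0 : (0 <= E)%E.
  by apply: le_trans Et; apply: integral_ge0 => w _; rewrite lee_fin nsq_ge0.
rewrite (le_trans Et)// -(fineK (_ : E \is a fin_num)) ?ge0_fin_numE//.
by rewrite lee_fin le_max lexx orbT.
Qed.

(** The drift integral is defined pathwise for almost all paths because its
    integrand is square integrable on the product space. *)
Let drift_moment (k1 k2 : R -> 'M[R]_d) X t : 0 <= t <= T ->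
  is_volterra_solution P F W T x0 b sigma k1 k2 X ->
  mx_measurable (`]0, T] : set R) k1 ->
  (\int[mu]_(s in `]0%R, T]) (nsq (k1 s))%:E < +oo)%E ->
  mx_measurable ((`[0, t[ : set R) `*` [set: Omega])
    (fun p : R * Omega => k1 (t - p.1) *m b (X p.1 p.2)) /\
  (\int[P]_w \int[mu]_(s in `[0%R, t[) (nsq (k1 (t - s) *m b (X s w)))%:E < +oo)%E.
Proof.
move=> /andP[t0 tT] hX mk k_fin.
have mX := mx_measurable_before tT (solution_measurable hX).
have mD : measurable ((`[0, t[ : set R) `*` [set: Omega]) by exact: measurableX.
have mbX := mx_measurable_lipschitz mD L0 b_lip mX.
have mh := mx_measurableM (mx_measurable_kernel tT mk) mbX.
split=> //.
have [M M0 XM] := moment_bound hX.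
have mk' : measurable_fun (`]0, T] : set R) (fun s => L * nsq (k1 s)).
  by apply: measurable_funM => //; exact: measurable_nsq.
have Lk0 s : 0 <= L * nsq (k1 s) by rewrite mulr_ge0 ?nsq_ge0 ?(ltW L0).
have mY : measurable_fun ((`[0, t[ : set R) `*` [set: Omega])
    (fun p : R * Omega => 1 + nsq (X p.1 p.2)).
  by apply: measurable_funD => //; exact: measurable_nsq.
have Y0 s w : 0 <= 1 + nsq (X s w) by rewrite addr_ge0 ?nsq_ge0.
apply: (@le_lt_trans _ _ (\int[P]_w \int[mu]_(s in `[0%R, t[)
    (L * nsq (k1 (t - s)) * (1 + nsq (X s w)))%:E)%E).
  apply: (@ge0_le_integral2 _ _ _ P _ (fun s w => nsq (k1 (t - s) *m b (X s w)))
    (fun s w => L * nsq (k1 (t - s)) * (1 + nsq (X s w)))) => //.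
  - exact: measurable_nsq mh.
  - apply: measurable_funM => //; apply: measurable_funM => //.
    by apply: measurable_nsq; exact: mx_measurable_kernel.
  - by move=> s w; exact: nsq_ge0.
  - by move=> s w; rewrite mulr_ge0.
  - move=> s w _; rewrite (le_trans (nsqM_le _ _))//.
    by rewrite [L * _]mulrC -mulrA ler_wpM2l ?nsq_ge0.
have XM1 s : 0 <= s -> s < t -> (\int[P]_w (1 + nsq (X s w))%:E <= (1 + M)%:E)%E.
  move=> s0 st; have sT : 0 <= s <= T by rewrite s0 (le_trans (ltW st)).
  apply: integral_add1_le; last exact: XM.
  by apply: (measurable_solution_at s0); exact: (solution_adapted hX).
have M1 : 0 <= 1 + M by rewrite addr_ge0.
apply: (le_lt_trans (convolution_moment_le tT mk' Lk0 mY Y0 M1 XM1)).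
rewrite lte_mul_pinfty ?lee_fin//.
apply: (@le_lt_trans _ _ (L%:E * \int[mu]_(s in `]0%R, T]) (nsq (k1 s))%:E)%E); last first.
  by rewrite lte_mul_pinfty// lee_fin ltW.
rewrite -ge0_integralZl ?lee_fin ?(ltW L0)//; last 2 first.
- by apply/measurable_EFinP; exact: measurable_nsq.
- by move=> s _; rewrite lee_fin nsq_ge0.
apply: ge0_subset_integral => //.
- exact/measurable_EFinP.
- by move=> s _; rewrite lee_fin.
- by move=> s /=; rewrite !in_itv/= => /andP[-> st]; exact: le_trans tT.
Qed.

Let sub_common_start (V : zmodType) (x a c a' c' : V) :
  x + a + c - (x + a' + c') = (a - a') + (c - c').
Proof.
by rewrite opprD addrACA; congr (_ + _); rewrite opprD addrACA subrr add0r.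
Qed.

(** Subtracting the two equations, almost surely X'_t - X_t is a difference of
    drifts plus a difference of Ito integrals. *)
Lemma volterra_difference_le (k1 k2 k1' k2' : R -> 'M[R]_d) X X' t :
  mx_measurable (`]0, T] : set R) k1 -> mx_measurable (`]0, T] : set R) k1' ->
  mx_measurable (`]0, T] : set R) k2 -> mx_measurable (`]0, T] : set R) k2' ->
  (\int[mu]_(s in `]0%R, T]) (nsq (k1 s))%:E < +oo)%E ->
  (\int[mu]_(s in `]0%R, T]) (nsq (k1' s))%:E < +oo)%E ->
  is_volterra_solution P F W T x0 b sigma k1 k2 X ->
  is_volterra_solution P F W T x0 b sigma k1' k2' X' ->
  0 <= t <= T ->
  (\int[P]_w (nsq (X' t w - X t w))%:E <=
   (2 * t)%:E * (\int[P]_w \int[mu]_(s in `[0%R, t[)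
      (nsq (k1' (t - s) *m b (X' s w) - k1 (t - s) *m b (X s w)))%:E) +
   2%:E * ((4 * (d%:R * kappa))%:E * (\int[P]_w \int[mu]_(s in `[0%R, t[)
      (nsq (k2' (t - s) *m sigma (X' s w) - k2 (t - s) *m sigma (X s w)))%:E)))%E.
Proof.
move=> mk1 mk1' mk2 mk2' fk1 fk1' hX hX' tT; have /andP[t0 tleT] := tT.
have [I hI XE] := solution_equation hX tT.
have [I' hI' X'E] := solution_equation hX' tT.
have [mh hfin] := drift_moment tT hX mk1 fk1.
have [mh' h'fin] := drift_moment tT hX' mk1' fk1'.
have ito := ito_integral_sub_le hF hW hI hI'.
have mI : mx_measurable setT I by case: hI.
have mI' : mx_measurable setT I' by case: hI'.
have mXt (Y : R -> Omega -> 'cV[R]_d) l1 l2 : is_volterra_solution P F W T x0 b sigma l1 l2 Y ->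
    mx_measurable setT (Y t).
  by move=> hY; apply: (measurable_solution_at t0); exact: (solution_adapted hY).
have mdh := mx_measurableB mh' mh.
have mXX' := mx_measurableB (mXt _ _ _ hX') (mXt _ _ _ hX).
have fin_ae (h : R * Omega -> 'cV[R]_d) :
    mx_measurable ((`[0, t[ : set R) `*` [set: Omega]) h ->
    (\int[P]_w \int[mu]_(s in `[0%R, t[) (nsq (h (s, w)))%:E < +oo)%E ->
    {ae P, forall w, (\int[mu]_(s in `[0%R, t[) (nsq (h (s, w)))%:E < +oo)%E}.
  move=> mm fin.
  have i : P.-integrable setT (fun w => \int[mu]_(s in `[0%R, t[) (nsq (h (s, w)))%:E)%E.
    apply/integrableP; split.
      apply: (measurable_tonelli_time (f := fun p => (nsq (h p))%:E)) => //.
        by apply/measurable_EFinP; exact: measurable_nsq.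
      by move=> p; rewrite lee_fin nsq_ge0.
    apply: le_lt_trans fin; rewrite le_eqVlt; apply/orP; left; apply/eqP.
    apply: eq_integral => w _; rewrite gee0_abs//.
    by apply: integral_ge0 => s _; rewrite lee_fin nsq_ge0.
  have := integrable_ae measurableT i; apply: filterS => w /(_ Logic.I).
  by rewrite ge0_fin_numE// integral_ge0// => s _; rewrite lee_fin nsq_ge0.
have ae1 := fin_ae _ mh hfin; have ae2 := fin_ae _ mh' h'fin.
pose q (w : Omega) : \bar R := (\int[mu]_(s in `[0%R, t[)
      (nsq (k1' (t - s) *m b (X' s w) - k1 (t - s) *m b (X s w)))%:E)%E.
have mq : measurable_fun setT q.
  apply: (measurable_tonelli_time (f := fun p =>
    (nsq (k1' (t - p.1) *m b (X' p.1 p.2) - k1 (t - p.1) *m b (X p.1 p.2)))%:E)) => //.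
    by apply/measurable_EFinP; exact: measurable_nsq.
  by move=> p; rewrite lee_fin nsq_ge0.
have q0 w : (0 <= q w)%E by apply: integral_ge0 => s _; rewrite lee_fin nsq_ge0.
have mII' : measurable_fun setT (fun w => (nsq (I' w - I w))%:E).
  by apply/measurable_EFinP; apply: measurable_nsq; exact: mx_measurableB.
have mq2 : measurable_fun setT (fun w => (2 * t)%:E * q w)%E by exact: measurable_funeM.
have mI2 : measurable_fun setT (fun w => 2%:E * (nsq (I' w - I w))%:E)%E.
  exact: measurable_funeM.
have t20 : (0 <= (2 * t)%:E)%E by rewrite lee_fin mulr_ge0.
have pointwise : {ae P, forall w, setT w -> ((nsq (X' t w - X t w))%:E <=
    (2 * t)%:E * q w + 2%:E * (nsq (I' w - I w))%:E)%E}.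
  near=> w => _.
  have Ew : X t w = x0 + (\col_i \int[mu]_(s in `[0, t[) ((k1 (t - s) *m b (X s w)) i 0)) + I w.
    by near: w.
  have E'w : X' t w = x0 + (\col_i \int[mu]_(s in `[0, t[) ((k1' (t - s) *m b (X' s w)) i 0)) + I' w.
    by near: w.
  have f1 : (\int[mu]_(s in `[0%R, t[) (nsq (k1 (t - s) *m b (X s w)))%:E < +oo)%E by near: w.
  have f2 : (\int[mu]_(s in `[0%R, t[) (nsq (k1' (t - s) *m b (X' s w)))%:E < +oo)%E by near: w.
  have mhw := mx_measurable_section (X := fun s w => k1 (t - s) *m b (X s w)) w (measurable_itv _) mh.
  have mh'w := mx_measurable_section (X := fun s w => k1' (t - s) *m b (X' s w)) w (measurable_itv _) mh'.
  have := drift_difference_le t0 mhw mh'w f1 f2.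
  rewrite Ew E'w -/(q w).
  set D := \col_i _; set D' := \col_i _ => cs.
  rewrite sub_common_start.
  apply: (@le_trans _ _ (2%:E * (nsq (D - D'))%:E + 2%:E * (nsq (I' w - I w))%:E)%E).
    by rewrite -!EFinM -EFinD lee_fin nsqD_le.
  by rewrite leeD2r// EFinM -muleA lee_wpmul2l.
apply: (@le_trans _ _ (\int[P]_w ((2 * t)%:E * q w + 2%:E * (nsq (I' w - I w))%:E))%E).
  apply: ae_ge0_le_integral => //.
  - by move=> w _; rewrite lee_fin nsq_ge0.
  - by apply/measurable_EFinP; exact: measurable_nsq.
  - by move=> w _; rewrite adde_ge0 ?mule_ge0 ?lee_fin ?nsq_ge0.
  - exact: emeasurable_funD.
rewrite ge0_integralD//; last 2 first.
- by move=> w _; rewrite mule_ge0.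
- by move=> w _; rewrite mule_ge0 ?lee_fin ?nsq_ge0.
rewrite ge0_integralZl//; apply: leeD2l.
rewrite ge0_integralZl//; last by move=> w _; rewrite lee_fin nsq_ge0.
by apply: lee_wpmul2l.
Unshelve. all: by end_near. Qed.

End stability.

(** * A Gronwall lemma for convolution kernels *)

Section convolution_gronwall.
Context {R : realType}.
Local Notation mu := (@lebesgue_measure R).
Variables (T : R) (k : R -> R).
Hypothesis mk : measurable_fun (`]0, T] : set R) k.
Hypothesis k0 : forall s, 0 <= k s.
Hypothesis k_fin : (\int[mu]_(s in `]0%R, T]) (k s)%:E < +oo)%E.

Let ik : mu.-integrable `]0, T] (EFin \o k).
Proof.
apply/integrableP; split; first exact/measurable_EFinP.
by under eq_integral do rewrite /= ger0_norm//.
Qed.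

(** Dominated convergence as beta tends to infinity. *)
Lemma small_laplace_weight : exists2 beta : R, 0 <= beta &
  (\int[mu]_(s in `]0%R, T]) (k s * expR (- (beta * s)))%:E <= (2^-1)%:E)%E.
Proof.
have mf (n : nat) : measurable_fun (`]0, T] : set R) (fun s => (k s * expR (- (n%:R * s)))%:E).
  apply/measurable_EFinP; apply: measurable_funM => //.
  apply: measurableT_comp; first exact: measurable_expR.
  by apply: measurable_funTS; apply: measurable_funN; exact: measurable_funM.
have f_cvg : {ae mu, forall s, `]0, T]%classic s ->
    (k s * expR (- (n%:R * s)))%:E @[n --> \oo] --> cst 0%E s}.
  apply: aeW => s /=; rewrite in_itv/= => /andP[s0 _].
  apply: cvg_EFin; first exact: nearW.
  rewrite -[X in _ --> X](mulr0 (k s)); apply: cvgMl_tmp.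
  under eq_fun do rewrite -mulrN expRM_natl.
  apply: cvg_expr; rewrite ger0_norm ?expR_ge0// expRN invf_lt1 ?expR_gt0//.
  by rewrite expR_gt1.
have f_dom : {ae mu, forall s n, `]0, T]%classic s ->
    (`|(k s * expR (- (n%:R * s)))%:E| <= (EFin \o k) s)%E}.
  apply: aeW => s n /=; rewrite in_itv/= => /andP[s0 _].
  rewrite lee_fin ger0_norm ?mulr_ge0 ?expR_ge0// ler_piMr//.
  by rewrite -expR0 ler_expR oppr_le0 mulr_ge0// ltW.
have [_ _] := @dominated_convergence _ _ _ mu `]0, T]%classic (measurable_itv _)
  (fun n s => (k s * expR (- (n%:R * s)))%:E) (cst 0%E) (EFin \o k) mf
  (measurable_cst _) f_cvg ik f_dom.
rewrite integral0 => /fine_cvgP[fin] /cvgr_lt /(_ 2^-1) small.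
have {}small : \forall n \near \oo, fine (\int[mu]_(s in `]0%R, T])
    (k s * expR (- (n%:R * s)))%:E) < 2^-1 by apply: small; rewrite invr_gt0.
have [n [nfin nsmall]] := filter_ex (filterI fin small).
exists n%:R => //; apply: (@le_trans _ _ (fine _)%:E); last by rewrite lee_fin; exact: ltW nsmall.
by rewrite fineK.
Qed.

(** Let S be the supremum of e^(- beta s) f(s) over s <= t.  With beta from
    [small_laplace_weight] the inequality gives S <= a(t) + S / 2 because a is
    nondecreasing, hence S <= 2 a(t): here S is finite since f is bounded.
    The constant depends on T and k only. *)
Lemma convolution_gronwall : exists2 C : R, 0 < C &
  forall (f : R -> R) (a : R -> \bar R) (M : R),
    measurable_fun (`[0, T] : set R) f ->
    (forall t, 0 <= t <= T -> 0 <= f t <= M) ->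
    (forall t, 0 <= t <= T -> (0 <= a t)%E) ->
    (forall s t, 0 <= s -> s <= t -> t <= T -> (a s <= a t)%E) ->
    (forall t, 0 <= t <= T ->
      ((f t)%:E <= a t + \int[mu]_(s in `[0%R, t[) (k (t - s) * f s)%:E)%E) ->
  forall t, 0 <= t <= T -> ((f t)%:E <= C%:E * a t)%E.
Proof.
have [beta beta0 small] := small_laplace_weight.
exists (2 * expR (beta * T)); first by rewrite mulr_gt0 ?expR_gt0.
move=> f a M mf fM a0 a_mono ineq t /andP[t0 tT].
have C0 : 0 < 2 * expR (beta * T) by rewrite mulr_gt0 ?expR_gt0.
have a_le s : 0 <= s -> s <= t -> (a s <= a t)%E by move=> s0 st; exact: a_mono.
have : (0 <= a t)%E by apply: a0; rewrite t0.
move: a_le; case: (a t) => [al a_al||_ //]; last first.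
  by rewrite gt0_muley ?leey// lte_fin.
rewrite lee_fin => al0.
pose G : set R := [set expR (- (beta * s)) * f s | s in `[0, t]].
have f_in s : 0 <= s <= t -> 0 <= f s <= M.
  by move=> /andP[s0 st]; apply: fM; rewrite s0 (le_trans st).
have f_ge0 s : 0 <= s -> s <= t -> 0 <= f s.
  by move=> s0 st; have /andP[] : 0 <= f s <= M by apply: f_in; rewrite s0.
have ew1 s : 0 <= s -> expR (- (beta * s)) <= 1.
  by move=> s0; rewrite -expR0 ler_expR oppr_le0 mulr_ge0.
have Gsup : has_sup G.
  split; first by exists (expR (- (beta * 0)) * f 0); exists 0 => //=; rewrite in_itv/= lexx.
  exists M => _ [s /= + <-]; rewrite in_itv/= => st; have /andP[fs0 fsM] := f_in s st.
  have /andP[s0 _] := st.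
  by rewrite (le_trans _ fsM)// ler_piMl// ew1.
have G_ub s : 0 <= s <= t -> expR (- (beta * s)) * f s <= sup G.
  by move=> st; apply: ub_le_sup; [case: Gsup|exists s => //=; rewrite in_itv/=].
have f_G s : 0 <= s <= t -> f s <= sup G * expR (beta * s).
  by move=> st; rewrite -ler_pdivrMr ?expR_gt0// -expRN mulrC G_ub.
have G0 : 0 <= sup G.
  have := G_ub 0; rewrite lexx t0 mulr0 oppr0 expR0 mul1r => /(_ isT); apply: le_trans.
  exact: f_ge0.
(* f(r) <= sup G * e^(beta r) inside the convolution, and the identity
   e^(beta r) = e^(beta s) * e^(- beta (s - r)) exhibits the weighted integral
   of k, which is at most 1/2. *)
have key s : 0 <= s <= t -> expR (- (beta * s)) * f s <= al + sup G / 2.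
  move=> /andP[s0 st]; have sT := le_trans st tT.
  have mkf : measurable_fun `[0, s[ (fun r => (k (s - r) * f r)%:E).
    apply/measurable_EFinP; apply: measurable_funM.
      exact: (measurable_kernel sT mk).
    apply: measurable_funS mf => // r /=; rewrite !in_itv/= => /andP[-> /ltW rs].
    exact: le_trans sT.
  have mkw : measurable_fun (`]0, s] : set R) (fun x => (sup G * expR (beta * s) * (k x * expR (- (beta * x))))%:E).
    apply/measurable_EFinP; apply: measurable_funM => //; apply: measurable_funM.
      by apply: measurable_funS mk => // r /=; rewrite !in_itv/= => /andP[-> rs]; exact: le_trans sT.
    apply: measurableT_comp; first exact: measurable_expR.
    by apply: measurable_funTS; apply: measurable_funN; exact: measurable_funM.
  have kw0 x : 0 <= sup G * expR (beta * s) * (k x * expR (- (beta * x))).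
    by rewrite !mulr_ge0 ?expR_ge0.
  pose J := (\int[mu]_(r in `[0%R, s[) (k (s - r) * f r)%:E)%E.
  have conv : (J <= (sup G * expR (beta * s) / 2)%R%:E)%E.
    apply: (@le_trans _ _ (\int[mu]_(r in `[0%R, s[)
        (sup G * expR (beta * s) * (k (s - r) * expR (- (beta * (s - r)))))%:E)%E).
      apply: ge0_le_integral => //.
      - move=> r /=; rewrite in_itv/= => /andP[r0 rs]; rewrite lee_fin mulr_ge0//.
        exact: f_ge0 r0 (le_trans (ltW rs) st).
      - apply/measurable_EFinP.
        apply: (@measurable_kernel _ s (fun x => sup G * expR (beta * s) * (k x * expR (- (beta * x))))) => //.
        exact/measurable_EFinP.
      - move=> r /=; rewrite in_itv/= => /andP[r0 rs]; rewrite lee_fin.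
        have -> : sup G * expR (beta * s) * (k (s - r) * expR (- (beta * (s - r)))) =
            k (s - r) * (sup G * expR (beta * r)).
          have -> : beta * r = beta * s + - (beta * (s - r)) by ring.
          by rewrite expRD; ring.
        by rewrite ler_wpM2l// f_G// r0 (le_trans (ltW rs)).
    rewrite (@integral_convolution_reflect _ _
      (fun x => (sup G * expR (beta * s) * (k x * expR (- (beta * x))))%:E))//; last first.
      by move=> x _; rewrite lee_fin.
    have E0 : 0 <= sup G * expR (beta * s) by rewrite mulr_ge0 ?expR_ge0.
    have mkw' : measurable_fun (`]0, T] : set R) (fun x => (k x * expR (- (beta * x)))%:E).
      apply/measurable_EFinP; apply: measurable_funM => //.
      apply: measurableT_comp; first exact: measurable_expR.
      by apply: measurable_funTS; apply: measurable_funN; exact: measurable_funM.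
    have sub : (`]0, s] : set R) `<=` `]0, T].
      by move=> r /=; rewrite !in_itv/= => /andP[-> rs]; exact: le_trans sT.
    rewrite -[leLHS]/(\int[mu]_(x in `]0%R, s])
      ((sup G * expR (beta * s))%:E * (k x * expR (- (beta * x)))%:E))%E.
    rewrite ge0_integralZl//; last 2 first.
    - exact: (measurable_funS _ sub mkw').
    - by move=> x _; rewrite lee_fin mulr_ge0 ?expR_ge0.
    rewrite [leRHS]EFinM; apply: lee_wpmul2l; first by rewrite lee_fin.
    apply: le_trans small; apply: ge0_subset_integral => //.
    by move=> x _; rewrite lee_fin mulr_ge0 ?expR_ge0.
  have fs : f s <= al + sup G * expR (beta * s) / 2.
    rewrite -lee_fin EFinD.
    apply: (@le_trans _ _ (a s + J)%E); first by apply: ineq; rewrite s0.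
    by apply: leeD; [exact: a_al|exact: conv].
  have e0 : 0 < expR (- (beta * s)) by exact: expR_gt0.
  apply: (@le_trans _ _ (expR (- (beta * s)) * (al + sup G * expR (beta * s) / 2))).
    by rewrite ler_wpM2l// ltW.
  rewrite mulrDr lerD//; first by rewrite ler_piMl// ew1.
  by rewrite !mulrA [_ * sup G]mulrC -!mulrA [expR (- _) * _]mulrA expRN mulVf ?mul1r// gt_eqF// expR_gt0.
have G_le : sup G <= al + sup G / 2.
  apply: ge_sup; first by case: Gsup.
  by move=> _ [s /= + <-]; rewrite in_itv/=; exact: key.
have G2 : sup G <= 2 * al by lra.
rewrite -EFinM lee_fin (le_trans (f_G t _)) ?t0 ?lexx//.
rewrite mulrAC ler_pM ?expR_ge0//.
by rewrite ler_expR ler_wpM2l.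
Qed.

End convolution_gronwall.

(** * Laplace kernels *)

Section laplace_kernels.
Context {R : realType}.
Variable lambda : {measure set R -> \bar R}.
Hypothesis lambda_adm : admissible_measure lambda.
Local Notation mu := (@lebesgue_measure R).

Let measurable_exp_weight (D : set R) (t : R) :
  measurable_fun D (fun rho : R => expR (- (rho * t))).
Proof.
apply: measurable_funTS; apply: measurableT_comp; first exact: measurable_expR.
by apply: measurable_funN; exact: measurable_funM.
Qed.

Lemma integrable_exp_weight (t : R) : 0 < t ->
  lambda.-integrable `[0, +oo[ (EFin \o (fun rho => expR (- (rho * t)))).
Proof.
move=> t0; apply/integrableP; split; first exact/measurable_EFinP.
rewrite (eq_integral (fun rho : R => (expR (- (rho * t)))%:E)); last first.
  by move=> rho _; rewrite /= ger0_norm ?expR_ge0.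
by have [+ _] := lambda_adm; apply.
Qed.

Section scalar.
Variables (m : R -> R) (K : R).
Hypothesis mm : measurable_fun (`[0, +oo[ : set R) m.
Hypothesis mK : forall rho, 0 <= rho -> `|m rho| <= K.

Lemma integrable_laplace (t : R) : 0 < t ->
  lambda.-integrable `[0, +oo[ (EFin \o (fun rho => expR (- (rho * t)) * m rho)).
Proof.
move=> t0; apply: (@integrable_dominated _ _ _ lambda _ _ _
    (fun rho => K * expR (- (rho * t)))) => //.
- exact: measurable_funM.
- by apply: integrable_scaleR => //; exact: integrable_exp_weight.
- move=> rho /=; rewrite in_itv/= andbT => rho0.
  by rewrite normrM ger0_norm ?expR_ge0// mulrC ler_wpM2r ?expR_ge0// mK.
Qed.

(** Near t the integrand is dominated by K e^(- rho t / 2). *)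
Lemma laplace_continuous : {in `]0, +oo[%classic, continuous
  (fun t => \int[lambda]_(rho in `[0, +oo[) (expR (- (rho * t)) * m rho))}.
Proof.
move=> t; rewrite inE/= in_itv/= andbT => t0.
have t20 : 0 < t / 2 by rewrite divr_gt0.
apply: (@continuity_under_integral _ _ _ lambda (fun t rho => expR (- (rho * t)) * m rho)
  `[0, +oo[%classic (measurable_itv _) (t / 2) (t + 1) _ _
  (fun rho => K * expR (- (rho * (t / 2))))).
- move=> x /=; rewrite in_itv/= => /andP[tx _].
  by apply: integrable_laplace; exact: lt_trans tx.
- apply: aeW => rho _ x _; apply: cvgMr_tmp.
  apply: (@continuous_comp _ _ _ (fun x : R => - (rho * x)) expR); last exact: continuous_expR.
  by apply: cvgN; apply: cvgMl_tmp; exact: cvg_id.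
- by apply: integrable_scaleR => //; exact: integrable_exp_weight.
- move=> x /=; rewrite in_itv/= => /andP[tx _].
  apply: aeW => rho /=; rewrite in_itv/= andbT => rho0.
  rewrite normrM ger0_norm ?expR_ge0// mulrC.
  apply: ler_pM => //; first exact: mK.
  by rewrite ler_expR lerN2 ler_wpM2l// ltW.
- by rewrite inE/= in_itv/=; apply/andP; split; lra.
Qed.

(** Through continuity: as lambda is arbitrary on the negative half-line, it is
    not known to be s-finite, and Fubini's theorem does not apply to it. *)
Lemma measurable_laplace (T : R) : measurable_fun (`]0, T] : set R)
  (fun t => \int[lambda]_(rho in `[0, +oo[) (expR (- (rho * t)) * m rho)).
Proof.
have mpos : measurable_fun (`]0, +oo[ : set R)
    (fun t => \int[lambda]_(rho in `[0, +oo[) (expR (- (rho * t)) * m rho)).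
  apply: open_continuous_measurable_fun; first exact: interval_open.
  exact: laplace_continuous.
apply: measurable_funS mpos => // t /=.
by rewrite !in_itv/= => /andP[->].
Qed.

(** The kernel is at most K times the scalar kernel with M = 1, whose square is
    integrable near 0 by hypothesis. *)
Lemma laplace_norm_le (t : R) : 0 < t ->
  `|\int[lambda]_(rho in `[0, +oo[) (expR (- (rho * t)) * m rho)| <=
  K * \int[lambda]_(rho in `[0, +oo[) expR (- (rho * t)).
Proof.
move=> t0; have it := integrable_laplace t0.
apply: (le_trans (le_normr_Rintegral _ it)) => //.
rewrite -RintegralZl//; last exact: integrable_exp_weight.
apply: le_Rintegral => //.
- exact: integrable_norm it.
- by apply: integrable_scaleR => //; exact: integrable_exp_weight.
- move=> rho /=; rewrite in_itv/= andbT => rho0.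
  by rewrite normrM ger0_norm ?expR_ge0// mulrC ler_wpM2r ?expR_ge0// mK.
Qed.

End scalar.

Let Gr (t : R) := \int[lambda]_(rho in `[0, +oo[) expR (- (rho * t)).

Let GrE t : 0 < t -> Gbar lambda t = (Gr t)%:E.
Proof.
by move=> t0; rewrite /Gr (EFin_Rintegral (measurable_itv _))//; exact: integrable_exp_weight.
Qed.

Let measurable_Gr T : measurable_fun (`]0, T] : set R) Gr.
Proof.
have := @measurable_laplace (cst 1) 1 (measurable_cst _) _ T.
rewrite (_ : (fun t => \int[lambda]_(rho in _) _) = Gr); first by apply => ? _; rewrite normr1.
by apply/funext => t; apply: eq_Rintegral => rho _; rewrite /= mulr1.
Qed.

Lemma laplace_kernel_measurable d (M : R -> 'M[R]_d) (T : R) :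
  bounded_measurable_mx M -> mx_measurable (`]0, T] : set R) (laplace_kernel lambda M).
Proof.
move=> [mM [K MK]] i j.
rewrite (_ : (fun t => _) = fun t =>
    \int[lambda]_(rho in `[0, +oo[) (expR (- (rho * t)) * M rho i j)); last first.
  by apply/funext => t; rewrite mxE.
apply: (@measurable_laplace (fun rho => M rho i j) K); first exact: mM.
by move=> rho rho0; exact: le_trans (frob_entry_le _ _ _) (MK _ rho0).
Qed.

Lemma laplace_kernel_sqr_lty d (M : R -> 'M[R]_d) (T : R) : 0 < T ->
  bounded_measurable_mx M ->
  (\int[mu]_(s in `]0%R, T]) (nsq (laplace_kernel lambda M s))%:E < +oo)%E.
Proof.
move=> T0 bM; have mG := laplace_kernel_measurable (T := T) bM.
have [mM [K MK]] := bM.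
have entry t i j : 0 < t -> laplace_kernel lambda M t i j ^+ 2 <= K ^+ 2 * Gr t ^+ 2.
  move=> t0; rewrite /laplace_kernel mxE -exprMn -(real_normK (num_real (Rintegral _ _ _))).
  have h : `|\int[lambda]_(rho in `[0, +oo[) (expR (- (rho * t)) * M rho i j)| <= K * Gr t.
    apply: (@laplace_norm_le (fun rho => M rho i j) K) => //.
    by move=> rho rho0; exact: le_trans (frob_entry_le _ _ _) (MK _ rho0).
  by rewrite lerXn2r// nnegrE ?(le_trans _ h).
pose c : R := (d%:R * (d%:R * K ^+ 2)).
have c0 : 0 <= c by do 2 (apply: mulr_ge0; first exact: ler0n); exact: sqr_ge0.
have nsqG t : 0 < t -> nsq (laplace_kernel lambda M t) <= c * Gr t ^+ 2.
  move=> t0; apply: (@le_trans _ _ (\sum_(i < d) \sum_(j < d) K ^+ 2 * Gr t ^+ 2)).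
    by apply: ler_sum => i _; apply: ler_sum => j _; exact: entry.
  rewrite !sumr_const !card_ord -(mulr_natl (_ *+ _)) -(mulr_natl (K ^+ 2 * _)).
  by rewrite /c !mulrA.
have [_ /(_ T T0)] := lambda_adm.
have Gr2 s : s \in `]0, T]%classic -> (Gbar lambda s ^+ 2 = (Gr s ^+ 2)%:E)%E.
  by rewrite inE/= in_itv/= => /andP[s0 _]; rewrite (GrE s0) EFin_expe.
have -> : (\int[mu]_(s in `]0%R, T]) (Gbar lambda s ^+ 2) =
    \int[mu]_(s in `]0%R, T]) (Gr s ^+ 2)%:E)%E by apply: eq_integral; exact: Gr2.
move=> Gr2_lty.
have {Gr2_lty}: (c%:E * \int[mu]_(s in `]0%R, T]) (Gr s ^+ 2)%:E < +oo)%E.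
  by apply: lte_mul_pinfty => //; rewrite lee_fin.
apply: le_lt_trans; rewrite -ge0_integralZl//; last 2 first.
- by apply/measurable_EFinP; apply: measurable_funX; exact: measurable_Gr.
- by move=> s _; rewrite lee_fin sqr_ge0.
apply: ge0_le_integral => //.
- by move=> s _; rewrite lee_fin nsq_ge0.
- by apply/measurable_EFinP; exact: measurable_nsq.
- apply: measurable_funeM; apply/measurable_EFinP; apply: measurable_funX.
  exact: measurable_Gr.
- by move=> s /=; rewrite in_itv/= => /andP[s0 _]; rewrite -EFinM lee_fin nsqG.
Qed.

End laplace_kernels.

(** * Stability of Volterra equations *)

Section coefficient_difference.
Context {disp : measure_display} {Omega : measurableType disp} {R : realType} {d : nat}.
Variables (P : probability Omega R) (T : R).
Local Notation mu := (@lebesgue_measure R).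

(** Split k' c(X') - k c(X) = k' (c(X') - c(X)) + (k' - k) c(X): the first term
    is a convolution of the dominating kernel with the quantity to be estimated,
    the second one needs a moment of X alone. *)
Lemma coefficient_difference_le n (c : 'cV[R]_d -> 'M[R]_(d, n)) (L M t : R)
    (kbound : R -> R) (k k' : R -> 'M[R]_d) (X X' : R -> Omega -> 'cV[R]_d) :
  0 < L -> 0 <= M -> t <= T ->
  (forall x y, nsq (c x - c y) <= L * nsq (x - y)) ->
  (forall x, nsq (c x) <= L * (1 + nsq x)) ->
  measurable_fun (`]0, T] : set R) kbound -> (forall s, 0 <= kbound s) ->
  mx_measurable (`]0, T] : set R) k -> mx_measurable (`]0, T] : set R) k' ->
  (forall s, 0 < s <= T -> nsq (k' s) <= kbound s) ->
  mx_measurable ((`[0, T] : set R) `*` [set: Omega]) (fun p : R * Omega => X p.1 p.2) ->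
  mx_measurable ((`[0, T] : set R) `*` [set: Omega]) (fun p : R * Omega => X' p.1 p.2) ->
  (forall s, 0 <= s -> s < t -> (\int[P]_w (1 + nsq (X s w))%:E <= M%:E)%E) ->
  (\int[P]_w \int[mu]_(s in `[0%R, t[)
      (nsq (k' (t - s) *m c (X' s w) - k (t - s) *m c (X s w)))%:E <=
   (2 * L)%:E * (\int[P]_w \int[mu]_(s in `[0%R, t[)
      (kbound (t - s) * nsq (X' s w - X s w))%:E) +
   (2 * L)%:E * (M%:E * \int[mu]_(s in `]0%R, t]) (nsq (k' s - k s))%:E))%E.
Proof.
move=> L0 M0 tT c_lip c_growth mkb kb0 mk mk' k'_le mX mX' XM.
have mXt := mx_measurable_before tT mX; have mX't := mx_measurable_before tT mX'.
have mD : measurable ((`[0, t[ : set R) `*` [set: Omega]) by exact: measurableX.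
have mcX := mx_measurable_lipschitz mD L0 c_lip mXt.
have mcX' := mx_measurable_lipschitz mD L0 c_lip mX't.
have mkt := mx_measurable_kernel (Omega := Omega) tT mk.
have mkt' := mx_measurable_kernel (Omega := Omega) tT mk'.
have mdk : mx_measurable (`]0, T] : set R) (fun s => k' s - k s) by exact: mx_measurableB.
have mdkt := mx_measurable_kernel (Omega := Omega) tT mdk.
have mndk := measurable_nsq mdk.
have mkbt : measurable_fun ((`[0, t[ : set R) `*` [set: Omega])
    (fun p : R * Omega => kbound (t - p.1)).
  apply: (@measurable_fun_fst _ _ _ _ (fun s => kbound (t - s))) => //.
  exact: (measurable_kernel tT mkb).
have mY : measurable_fun ((`[0, t[ : set R) `*` [set: Omega])
    (fun p : R * Omega => 1 + nsq (X p.1 p.2)).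
  by apply: measurable_funD => //; exact: measurable_nsq.
have Y0 s w : 0 <= 1 + nsq (X s w) by rewrite addr_ge0 ?nsq_ge0.
have L20 : 0 <= 2 * L by rewrite mulr_ge0 ?(ltW L0).
apply: (@le_trans _ _ ((2 * L)%:E * (\int[P]_w \int[mu]_(s in `[0%R, t[)
      (kbound (t - s) * nsq (X' s w - X s w))%:E) +
   (2 * L)%:E * (\int[P]_w \int[mu]_(s in `[0%R, t[)
      (nsq (k' (t - s) - k (t - s)) * (1 + nsq (X s w)))%:E))%E).
  apply: (@ge0_le_integral2_lin2 _ _ _ P _
    (fun s w => nsq (k' (t - s) *m c (X' s w) - k (t - s) *m c (X s w)))
    (fun s w => kbound (t - s) * nsq (X' s w - X s w))
    (fun s w => nsq (k' (t - s) - k (t - s)) * (1 + nsq (X s w)))) => //.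
  - apply: measurable_nsq; apply: mx_measurableB; exact: mx_measurableM.
  - apply: measurable_funM => //; apply: measurable_nsq; exact: mx_measurableB.
  - apply: measurable_funM => //; exact: measurable_nsq mdkt.
  - by move=> s w; exact: nsq_ge0.
  - by move=> s w; rewrite mulr_ge0 ?nsq_ge0.
  - by move=> s w; rewrite mulr_ge0 ?nsq_ge0.
  move=> s w /=; rewrite in_itv/= => /andP[s0 st].
  have -> : k' (t - s) *m c (X' s w) - k (t - s) *m c (X s w) =
      k' (t - s) *m (c (X' s w) - c (X s w)) + (k' (t - s) - k (t - s)) *m c (X s w).
    by rewrite mulmxBr mulmxBl addrA subrK.
  rewrite (le_trans (nsqD_le _ _))// -!mulrA lerD// ler_wpM2l//.
  - rewrite (le_trans (nsqM_le _ _))// mulrCA.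
    rewrite ler_pM ?nsq_ge0 ?c_lip//.
    apply: k'_le; rewrite subr_gt0 st/=.
    by rewrite (le_trans _ tT)// gerBl.
  - by rewrite (le_trans (nsqM_le _ _))// mulrCA ler_wpM2l ?nsq_ge0 ?c_growth.
apply: leeD2l; apply: lee_wpmul2l; first by rewrite lee_fin.
by apply: (convolution_moment_le tT mndk _ mY Y0 M0 XM) => s; exact: nsq_ge0.
Qed.

End coefficient_difference.

Section volterra_stability.
Context {R : realType}.
Local Notation mu := (@lebesgue_measure R).
Local Notation kappa := (gauss_second_moment R).

(** Collects the bounds of the drift and of the Ito integral into the form
    x <= a(t) + (k * f)(t), on abstract extended reals. *)
Let gronwall_form (x A1 A2 I1 I2 J : \bar R) (t T e L m : R) :
  (0 <= t)%R -> (t <= T)%R -> (0 <= e)%R -> (0 <= L)%R -> (0 <= m)%R ->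
  (0 <= I1)%E -> (0 <= I2)%E -> (0 <= J)%E -> (0 <= A1)%E -> (0 <= A2)%E ->
  (A1 <= (2 * L)%:E * J + (2 * L)%:E * (m%:E * I1))%E ->
  (A2 <= (2 * L)%:E * J + (2 * L)%:E * (m%:E * I2))%E ->
  (x <= (2 * t)%:E * A1 + 2%:E * ((4 * e)%:E * A2))%E ->
  (x <= (2 * L * (2 * T + 8 * e) * m)%:E * (I1 + I2) + (4 * L * (2 * T + 8 * e))%:E * J)%E.
Proof.
move=> t0 tT e0 L0 m0 I10 I20 J0 A10 A20 A1le A2le /le_trans; apply.
have T0 := le_trans t0 tT.
set D := (2 * T + 8 * e)%R.
have D0 : (0 <= D)%R by rewrite addr_ge0 ?mulr_ge0.
apply: (@le_trans _ _ (D%:E * A1 + D%:E * A2)%E).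
  rewrite muleA -EFinM; apply: leeD; apply: lee_wpmul2r => //; rewrite lee_fin /D; lra.
apply: (@le_trans _ _ (D%:E * ((2 * L)%:E * J + (2 * L)%:E * (m%:E * I1)) +
    D%:E * ((2 * L)%:E * J + (2 * L)%:E * (m%:E * I2)))%E).
  by apply: leeD; apply: lee_wpmul2l => //; rewrite lee_fin.
have L20 : (0 <= 2 * L)%R by rewrite mulr_ge0.
rewrite !ge0_muleDr ?mule_ge0 ?lee_fin// !muleA -!EFinM.
rewrite addeACA -ge0_muleDl ?lee_fin ?mulr_ge0//.
rewrite addeC -EFinD.
have -> : (D * (2 * L) + D * (2 * L) = 4 * L * D)%R by ring.
by have -> : (D * (2 * L) * m = 2 * L * D * m)%R by ring.
Qed.

(** The constant is chosen before the probability space, the solutions, and even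
    the coefficients and kernels, which are constrained by L and kbound only.
    The right-hand side still contains a moment bound M of the solution X. *)
Lemma volterra_stability (d : nat) (T L : R) (kbound : R -> R) :
  0 < T -> 0 < L ->
  measurable_fun (`]0, T] : set R) kbound -> (forall s, 0 <= kbound s) ->
  (\int[mu]_(s in `]0%R, T]) (kbound s)%:E < +oo)%E ->
  exists2 C : R, 0 < C &
  forall (disp : measure_display) (Omega : measurableType disp)
    (P : probability Omega R) (F : R -> set_system Omega) (W : R -> Omega -> 'cV[R]_d)
    (x0 : 'cV[R]_d) (b : 'cV[R]_d -> 'cV[R]_d) (sigma : 'cV[R]_d -> 'M[R]_d)
    (K1 K2 K1' K2' : R -> 'M[R]_d) (X X' : R -> Omega -> 'cV[R]_d) (M : R),
  is_filtration F -> is_brownian P F W ->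
  (forall x y, nsq (b x - b y) <= L * nsq (x - y)) ->
  (forall x y, nsq (sigma x - sigma y) <= L * nsq (x - y)) ->
  (forall x, nsq (b x) <= L * (1 + nsq x)) ->
  (forall x, nsq (sigma x) <= L * (1 + nsq x)) ->
  mx_measurable (`]0, T] : set R) K1 -> mx_measurable (`]0, T] : set R) K2 ->
  mx_measurable (`]0, T] : set R) K1' -> mx_measurable (`]0, T] : set R) K2' ->
  (forall s, 0 < s <= T -> nsq (K1 s) <= kbound s) ->
  (forall s, 0 < s <= T -> nsq (K1' s) <= kbound s) ->
  (forall s, 0 < s <= T -> nsq (K2' s) <= kbound s) ->
  is_volterra_solution P F W T x0 b sigma K1 K2 X ->
  is_volterra_solution P F W T x0 b sigma K1' K2' X' ->
  0 <= M ->
  (forall t, 0 <= t <= T -> (\int[P]_w (nsq (X t w))%:E <= M%:E)%E) ->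
  forall t, 0 <= t <= T ->
  (\int[P]_w (nsq (X' t w - X t w))%:E <=
   (C * (1 + M))%:E * \int[mu]_(s in `]0%R, t])
     (nsq (K1' s - K1 s) + nsq (K2' s - K2 s))%:E)%E.
Proof.
move=> T0 L0 mkb kb0 kb_fin.
set e : R := d%:R * kappa; have e0 : 0 <= e by rewrite mulr_ge0// gauss_second_moment_ge0.
set D := 2 * T + 8 * e.
have D0 : 0 < D by rewrite /D; lra.
have LD0 : 0 <= 4 * L * D by rewrite ltW// mulr_gt0// mulr_gt0.
have mk : measurable_fun (`]0, T] : set R) (fun s => 4 * L * D * kbound s).
  exact: measurable_funM.
have k0 s : 0 <= 4 * L * D * kbound s by rewrite mulr_ge0.
have k_fin : (\int[mu]_(s in `]0%R, T]) (4 * L * D * kbound s)%:E < +oo)%E.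
  rewrite -[ltLHS]/(\int[mu]_(s in `]0%R, T]) ((4 * L * D)%:E * (kbound s)%:E))%E.
  rewrite ge0_integralZl ?lee_fin//; last 2 first.
  - exact/measurable_EFinP.
  - by move=> s _; rewrite lee_fin.
  by apply: lte_mul_pinfty => //; rewrite lee_fin.
have [Cg Cg0 gronwall] := convolution_gronwall mk k0 k_fin.
exists (Cg * (2 * L * D)); first by rewrite !mulr_gt0.
move=> disp Omega P F W x0 b sigma K1 K2 K1' K2' X X' M hF hW b_lip s_lip b_gr s_gr
  mK1 mK2 mK1' mK2' K1le K1'le K2'le hX hX' M0 XM t tT.
have mX := solution_measurable hX; have mX' := solution_measurable hX'.
have mXs s : 0 <= s <= T -> mx_measurable setT (X s).
  move=> sT; have /andP[s0 _] := sT.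
  exact: (measurable_solution_at hF s0 (solution_adapted hX sT)).
have mX's s : 0 <= s <= T -> mx_measurable setT (X' s).
  move=> sT; have /andP[s0 _] := sT.
  exact: (measurable_solution_at hF s0 (solution_adapted hX' sT)).
have [M' M'0 X'M] := moment_bound hX'.
pose fE (s : R) : \bar R := (\int[P]_w (nsq (X' s w - X s w))%:E)%E.
have fE0 s : (0 <= fE s)%E by apply: integral_ge0 => w _; rewrite lee_fin nsq_ge0.
pose B := 2 * M' + 2 * M.
have fEB s : 0 <= s <= T -> (fE s <= B%:E)%E.
  move=> sT; rewrite /B EFinD !EFinM.
  apply: (@le_trans _ _ (2%:E * (\int[P]_w (nsq (X' s w))%:E) + 2%:E * (\int[P]_w (nsq (X s w))%:E))%E).
    have := @ge0_le_integral_lin3 _ _ _ P setT (fun w => (nsq (X' s w - X s w))%:E)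
      (fun w => (nsq (X' s w))%:E) (fun w => (nsq (X s w))%:E) (cst 0%E) 2 2 0 measurableT.
    rewrite mul0e adde0; apply => //; try by move=> w _; rewrite lee_fin nsq_ge0.
    - by apply/measurable_EFinP; apply: measurable_nsq; apply: mx_measurableB; [exact: mX's|exact: mXs].
    - by apply/measurable_EFinP; apply: measurable_nsq; exact: mX's.
    - by apply/measurable_EFinP; apply: measurable_nsq; exact: mXs.
    - by move=> w _; rewrite mul0e adde0 -!EFinM -EFinD lee_fin nsqB_le.
  by apply: leeD; apply: lee_wpmul2l => //; [exact: X'M|exact: XM].
have fE_fin s : 0 <= s <= T -> fE s = (fine (fE s))%:E.
  move=> sT; rewrite fineK// ge0_fin_numE//.
  by apply: le_lt_trans (fEB s sT) _; exact: ltry.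
have mDX : mx_measurable ((`[0, T] : set R) `*` [set: Omega])
    (fun p : R * Omega => X' p.1 p.2 - X p.1 p.2) by exact: mx_measurableB.
have mf : measurable_fun (`[0, T] : set R) (fun s => fine (fE s)).
  apply: (measurableT_comp (fine_measurable measurableT)).
  apply: (@measurable_tonelli_space _ _ _ P _ (fun p => (nsq (X' p.1 p.2 - X p.1 p.2))%:E)) => //.
  - by apply/measurable_EFinP; exact: measurable_nsq.
  - by move=> p; rewrite lee_fin nsq_ge0.
pose I (t : R) : \bar R := (\int[mu]_(s in `]0%R, t]) (nsq (K1' s - K1 s) + nsq (K2' s - K2 s))%:E)%E.
have mdK1 := measurable_nsq (mx_measurableB mK1' mK1).
have mdK2 := measurable_nsq (mx_measurableB mK2' mK2).
have sub s : s <= T -> (`]0, s] : set R) `<=` `]0, T].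
  by move=> sT r /=; rewrite !in_itv/= => /andP[-> rs]; exact: le_trans sT.
have I0 s : (0 <= I s)%E.
  by apply: integral_ge0 => r _; rewrite lee_fin addr_ge0 ?nsq_ge0.
have I_mono s r : s <= r -> r <= T -> (I s <= I r)%E.
  move=> sr rT; apply: ge0_subset_integral => //.
  - apply/measurable_EFinP; apply: measurable_funD.
    + exact: (measurable_funS _ (sub r rT) mdK1).
    + exact: (measurable_funS _ (sub r rT) mdK2).
  - by move=> x _; rewrite lee_fin addr_ge0 ?nsq_ge0.
  - by move=> x /=; rewrite !in_itv/= => /andP[-> xs]; exact: le_trans sr.
have M10 : 0 <= 1 + M by rewrite addr_ge0.
have cI0 : 0 <= 2 * L * D * (1 + M) by rewrite mulr_ge0// ltW// mulr_gt0// mulr_gt0.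
have fin_of (K : R -> 'M[R]_d) : mx_measurable (`]0, T] : set R) K ->
    (forall s, 0 < s <= T -> nsq (K s) <= kbound s) ->
    (\int[mu]_(s in `]0%R, T]) (nsq (K s))%:E < +oo)%E.
  move=> mK Kle; apply: le_lt_trans kb_fin; apply: ge0_le_integral => //.
  - by move=> s _; rewrite lee_fin nsq_ge0.
  - by apply/measurable_EFinP; exact: measurable_nsq.
  - exact/measurable_EFinP.
have XM1 s : 0 <= s <= T -> (\int[P]_w (1 + nsq (X s w))%:E <= (1 + M)%:E)%E.
  by move=> sT; apply: integral_add1_le; [exact: mXs|exact: XM].
have ineq s : 0 <= s <= T -> ((fine (fE s))%:E <= (2 * L * D * (1 + M))%:E * I s +
    \int[mu]_(r in `[0%R, s[) (4 * L * D * kbound (s - r) * fine (fE r))%:E)%E.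
  move=> sT; have /andP[s0 sleT] := sT.
  rewrite -(fE_fin s sT).
  pose J : \bar R := (\int[P]_w \int[mu]_(r in `[0%R, s[)
      (kbound (s - r) * nsq (X' r w - X r w))%:E)%E.
  have J0 : (0 <= J)%E.
    by apply: integral_ge0 => w _; apply: integral_ge0 => r _; rewrite lee_fin mulr_ge0 ?nsq_ge0.
  have mDXs := mx_measurable_before (X := fun r w => X' r w - X r w) sleT mDX.
  have JE : ((4 * L * D)%:E * J = \int[mu]_(r in `[0%R, s[)
      (4 * L * D * kbound (s - r) * fine (fE r))%:E)%E.
    rewrite /J (tonelli_convolution (Y := fun r w => nsq (X' r w - X r w)) P sleT mkb kb0
      (measurable_nsq mDXs) (fun _ _ => nsq_ge0 _)).
    rewrite -ge0_integralZl ?lee_fin//; last 2 first.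
    - apply: emeasurable_funM.
        by apply/measurable_EFinP; exact: (measurable_kernel sleT mkb).
      apply: (@measurable_tonelli_space _ _ _ P _ (fun p => (nsq (X' p.1 p.2 - X p.1 p.2))%:E)) => //.
      + by apply/measurable_EFinP; exact: measurable_nsq.
      + by move=> p; rewrite lee_fin nsq_ge0.
    - by move=> r _; rewrite mule_ge0 ?lee_fin// fE0.
    apply: eq_integral => r; rewrite inE/= in_itv/= => /andP[r0 rs].
    rewrite -/(fE r) fE_fin ?r0 ?(le_trans (ltW rs))//.
    by rewrite -!EFinM mulrA.
  rewrite -JE.
  have XM1' r : 0 <= r -> r < s -> (\int[P]_w (1 + nsq (X r w))%:E <= (1 + M)%:E)%E.
    by move=> r0 rs; apply: XM1; rewrite r0 (le_trans (ltW rs)).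
  have h1 := coefficient_difference_le L0 M10 sleT b_lip b_gr mkb kb0 mK1 mK1' K1'le mX mX' XM1'.
  have h2 := coefficient_difference_le L0 M10 sleT s_lip s_gr mkb kb0 mK2 mK2' K2'le mX mX' XM1'.
  have h := volterra_difference_le hF hW L0 b_lip b_gr mK1 mK1' mK2 mK2'
    (fin_of K1 mK1 K1le) (fin_of K1' mK1' K1'le) hX hX' sT.
  have IE : I s = (\int[mu]_(r in `]0%R, s]) (nsq (K1' r - K1 r))%:E +
      \int[mu]_(r in `]0%R, s]) (nsq (K2' r - K2 r))%:E)%E.
    rewrite -ge0_integralD//.
    - by move=> r _; rewrite lee_fin nsq_ge0.
    - by apply/measurable_EFinP; exact: (measurable_funS _ (sub s sleT) mdK1).
    - by move=> r _; rewrite lee_fin nsq_ge0.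
    - by apply/measurable_EFinP; exact: (measurable_funS _ (sub s sleT) mdK2).
  rewrite IE.
  apply: (gronwall_form s0 sleT e0 (ltW L0) M10 _ _ J0 _ _ h1 h2 h).
  - by apply: integral_ge0 => r _; rewrite lee_fin nsq_ge0.
  - by apply: integral_ge0 => r _; rewrite lee_fin nsq_ge0.
  - by apply: integral_ge0 => w _; apply: integral_ge0 => r _; rewrite lee_fin nsq_ge0.
  - by apply: integral_ge0 => w _; apply: integral_ge0 => r _; rewrite lee_fin nsq_ge0.
have fB s : 0 <= s <= T -> 0 <= fine (fE s) <= B.
  by move=> sT; rewrite fine_ge0//= -lee_fin -fE_fin// fEB.
have a0 s : 0 <= s <= T -> (0 <= (2 * L * D * (1 + M))%:E * I s)%E.
  by move=> _; rewrite mule_ge0 ?lee_fin.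
have a_mono s r : 0 <= s -> s <= r -> r <= T ->
    ((2 * L * D * (1 + M))%:E * I s <= (2 * L * D * (1 + M))%:E * I r)%E.
  by move=> _ sr rT; apply: lee_wpmul2l; [rewrite lee_fin|exact: I_mono].
have := gronwall (fun s => fine (fE s)) _ B mf fB a0 a_mono ineq t tT.
by rewrite -fE_fin// muleA -EFinM [X in (X%:E * _)%E]mulrA.
Qed.

End volterra_stability.

Section constant_solution.
Context {disp : measure_display} {Omega : measurableType disp} {R : realType} {d : nat}.
Variables (P : probability Omega R) (F : R -> set_system Omega).
Variables (W : R -> Omega -> 'cV[R]_d) (T : R).
Hypothesis hF : is_filtration F.

Let mx_measurable_wrt_cst m n t (A : 'M[R]_(m, n)) : 0 <= t ->
  mx_measurable_wrt (F t) (fun=> A).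
Proof. by move=> t0 i j; apply: measurable_wrt_cst; exact: (filtration_sigma hF). Qed.

(** A reference solution with known moments, to which any other solution can be
    compared. *)
Lemma constant_volterra_solution x0 (b : 'cV[R]_d -> 'cV[R]_d) (sigma : 'cV[R]_d -> 'M[R]_d) :
  is_volterra_solution P F W T x0 b sigma (fun=> 0) (fun=> 0) (fun _ _ => x0).
Proof.
have frob0 m n : frob (0 : 'M[R]_(m, n)) ^+ 2 = 0 by rewrite frob_sqr nsq0.
split.
- exact: mx_measurable_cst.
- by move=> t /andP[t0 _]; exact: mx_measurable_wrt_cst.
- apply: (@le_lt_trans _ _ (frob x0 ^+ 2)%:E); last exact: ltry.
  apply: ub_ereal_sup => _ [t _ <-].
  by rewrite expectation_cst.
- move=> t _; exists (fun=> 0); last first.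
    apply: aeW => w; rewrite addr0.
    rewrite (_ : \col_i _ = 0) ?addr0//; apply/colP => i; rewrite [LHS]mxE [RHS]mxE.
    rewrite (@eq_Rintegral _ _ _ _ _ (cst 0)); last by move=> s _; rewrite /= mul0mx mxE.
    by rewrite Rintegral_cst ?mul0r.
  split.
  + split.
    * rewrite (_ : (fun p => _) = cst 0); last by apply/funext => p; rewrite /= mul0mx.
      exact: mx_measurable_cst.
    * move=> s /andP[s0 _]; rewrite (_ : (fun w => _) = cst 0); last by apply/funext => w; rewrite /= mul0mx.
      exact: mx_measurable_wrt_cst.
    * rewrite (eq_integral (cst 0%E)) ?integral0 ?ltry// => w _.
      by rewrite (eq_integral (cst 0%E)) ?integral0// => s _; rewrite /= mul0mx frob0.
  + exact: mx_measurable_cst.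
  pose S0 : simple_process Omega R d d := @SimpleProcess Omega R d d 0
    (fun=> 0) (fun=> 0) (fun _ _ => 0).
  exists (fun=> S0); split.
  + by move=> n [].
  + rewrite (_ : (fun n => _) = cst 0%E); first exact: cvg_cst.
    apply/funext => n; rewrite (eq_integral (cst 0%E)) ?integral0// => w _.
    rewrite (eq_integral (cst 0%E)) ?integral0// => s _.
    by rewrite /= mul0mx /simple_val big_ord0 subr0 frob0.
  + rewrite (_ : (fun n => _) = cst 0%E); first exact: cvg_cst.
    apply/funext => n; rewrite (_ : (fun w => _) = cst 0) ?expectation_cst//.
    by apply/funext => w; rewrite /simple_integral big_ord0 subr0 frob0.
Qed.

End constant_solution.

(** * The main estimate *)

Lemma moment_shift_le {R : realType} {disp : measure_display} {Omega : measurableType disp} {d : nat}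
    (P : probability Omega R) (Y : Omega -> 'cV[R]_d) (y : 'cV[R]_d) (B : R) :
  mx_measurable setT Y ->
  (\int[P]_w (nsq (Y w - y))%:E <= B%:E)%E ->
  (\int[P]_w (nsq (Y w))%:E <= (2 * B + 2 * nsq y)%:E)%E.
Proof.
move=> mY YB.
have mYy : mx_measurable setT (fun w => Y w - y).
  by apply: mx_measurableB => //; exact: mx_measurable_cst.
have h := @ge0_le_integral_lin3 _ _ _ P setT (fun w => (nsq (Y w))%:E)
  (fun w => (nsq (Y w - y))%:E) (fun=> (nsq y)%:E) (cst 0%E) 2 2 0 measurableT.
apply: (@le_trans _ _ (2%:E * (\int[P]_w (nsq (Y w - y))%:E) + 2%:E * (\int[P]_w (nsq y)%:E))%E).
  move: h; rewrite mul0e adde0; apply => //; try by move=> w _; rewrite lee_fin nsq_ge0.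
  - by apply/measurable_EFinP; exact: measurable_nsq.
  - by apply/measurable_EFinP; exact: measurable_nsq.
  - move=> w _; rewrite mul0e adde0 -!EFinM -EFinD lee_fin.
    by rewrite -{1}[Y w](subrK y) nsqD_le.
rewrite integral_cst//= (_ : P [set: Omega] = 1%E); last exact: probability_setT.
rewrite mule1 -[leRHS]/(2%:E * B%:E + 2%:E * (nsq y)%:E)%E.
by apply: leeD2r; apply: lee_wpmul2l.
Qed.


Theorem theorem3p1 (R : realType) (d : nat) (d_ge1 : (1 <= d)%N)
    (x0 : 'cV[R]_d)
    (b : 'cV[R]_d -> 'cV[R]_d) (sigma : 'cV[R]_d -> 'M[R]_d)
    (b_sigma_lip : lipschitz_coeffs b sigma)
    (lambda : {measure set R -> \bar R})
    (lambda_adm : admissible_measure lambda)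
    (M1 M2 : R -> 'M[R]_d)
    (M1_bnd : bounded_measurable_mx M1) (M2_bnd : bounded_measurable_mx M2)
    (T : R) (T_gt0 : 0 < T) (Cbar : R) (Cbar_gt0 : 0 < Cbar) :
  let G1 := laplace_kernel lambda M1 in
  let G2 := laplace_kernel lambda M2 in
  exists2 C : R, 0 < C &
    forall hG1 hG2 : R -> 'M[R]_d,
      mx_measurable (`]0, T] : set R) hG1 -> mx_measurable (`]0, T] : set R) hG2 ->
      (forall t : R, 0 < t <= T ->
        frob (hG1 t) ^+ 2 <= Cbar * (1 + frob (G1 t) ^+ 2)) ->
      (forall t : R, 0 < t <= T ->
        frob (hG2 t) ^+ 2 <= Cbar * (1 + frob (G2 t) ^+ 2)) ->
    forall (disp : measure_display) (Omega : measurableType disp)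
      (P : probability Omega R) (F : R -> set_system Omega)
      (W : R -> Omega -> 'cV[R]_d),
      is_filtration F -> is_brownian P F W ->
    forall X hX : R -> Omega -> 'cV[R]_d,
      is_volterra_solution P F W T x0 b sigma G1 G2 X ->
      is_volterra_solution P F W T x0 b sigma hG1 hG2 hX ->
    forall t : R, 0 <= t <= T ->
      ('E_P[fun w => (frob (hX t w - X t w) ^+ 2)%R] <=
        C%:E * \int[lebesgue_measure]_(s in `]0%R, t])
          (frob (hG1 s - G1 s) ^+ 2 + frob (hG2 s - G2 s) ^+ 2)%:E)%E.
Proof.
move=> G1 G2.
have [L L0 [b_lip s_lip b_gr s_gr]] := lipschitz_nsq b_sigma_lip.
have mG1 : mx_measurable (`]0, T] : set R) G1 by exact: laplace_kernel_measurable.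
have mG2 : mx_measurable (`]0, T] : set R) G2 by exact: laplace_kernel_measurable.
have G1_lty : (\int[lebesgue_measure]_(s in `]0%R, T]) (nsq (G1 s))%:E < +oo)%E.
  exact: (laplace_kernel_sqr_lty lambda_adm T_gt0 M1_bnd).
have G2_lty : (\int[lebesgue_measure]_(s in `]0%R, T]) (nsq (G2 s))%:E < +oo)%E.
  exact: (laplace_kernel_sqr_lty lambda_adm T_gt0 M2_bnd).
clearbody G1 G2.
pose g s := nsq (G1 s) + nsq (G2 s).
have g0 s : 0 <= g s by rewrite addr_ge0 ?nsq_ge0.
have iG (G : R -> 'M[R]_d) : mx_measurable (`]0, T] : set R) G ->
    (\int[lebesgue_measure]_(s in `]0%R, T]) (nsq (G s))%:E < +oo)%E ->
    lebesgue_measure.-integrable `]0, T] (EFin \o (fun s => nsq (G s))).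
  move=> mG G_lty; apply/integrableP; split.
    by apply/measurable_EFinP; exact: measurable_nsq.
  by under eq_integral do rewrite /= ger0_norm ?nsq_ge0//.
have ig : lebesgue_measure.-integrable `]0, T] (EFin \o g).
  by apply: integrable_addR; [by []|exact: (iG G1 mG1 G1_lty)|exact: (iG G2 mG2 G2_lty)].
have mg : measurable_fun (`]0, T] : set R) g.
  by apply: measurable_funD; exact: measurable_nsq.
have C10 : 0 <= 1 + Cbar by rewrite addr_ge0// ltW.
pose kbound s := (1 + Cbar) * (1 + g s).
have kb0 s : 0 <= kbound s by rewrite mulr_ge0// addr_ge0.
have mkb : measurable_fun (`]0, T] : set R) kbound.
  by apply: measurable_funM => //; exact: measurable_funD.
have kb_lty : (\int[lebesgue_measure]_(s in `]0%R, T]) (kbound s)%:E < +oo)%E.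
  have /integrableP[_] : lebesgue_measure.-integrable `]0, T] (EFin \o kbound).
    apply: integrable_scaleR => //; apply: (integrable_addR _ (f := cst 1)) => //.
    by apply: integrable_cst_lty => //; exact: lebesgue_bounded_itv_lty.
  by under eq_integral do rewrite /= ger0_norm//.
have [C C0 stability] := volterra_stability d T_gt0 L0 mkb kb0 kb_lty.
have x00 := nsq_ge0 x0.
pose B := C * (1 + nsq x0) * fine (\int[lebesgue_measure]_(s in `]0%R, T]) (g s)%:E)%E.
pose M := 2 * B + 2 * nsq x0.
have gi0 : (0 <= \int[lebesgue_measure]_(s in `]0%R, T]) (g s)%:E)%E.
  by apply: integral_ge0 => s _; rewrite lee_fin.
have B0 : 0 <= B by rewrite mulr_ge0 ?fine_ge0// mulr_ge0 ?addr_ge0// ltW.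
have M0 : 0 <= M by apply: addr_ge0; exact: mulr_ge0.
exists (C * (1 + M)); first by rewrite mulr_gt0// ltr_pwDl.
move=> hG1 hG2 mhG1 mhG2 hG1_le hG2_le disp Omega P F W hF hW X hX solX solhX t tT.
have G1_le s : 0 < s <= T -> nsq (G1 s) <= kbound s.
  move=> _; rewrite /kbound /g; have := nsq_ge0 (G1 s); have := nsq_ge0 (G2 s); nra.
have G2_le s : 0 < s <= T -> nsq (G2 s) <= kbound s.
  move=> _; rewrite /kbound /g; have := nsq_ge0 (G1 s); have := nsq_ge0 (G2 s); nra.
have hG1_kb s : 0 < s <= T -> nsq (hG1 s) <= kbound s.
  move=> sT; have := hG1_le s sT; rewrite !frob_sqr /kbound /g.
  have := nsq_ge0 (G1 s); have := nsq_ge0 (G2 s); nra.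
have hG2_kb s : 0 < s <= T -> nsq (hG2 s) <= kbound s.
  move=> sT; have := hG2_le s sT; rewrite !frob_sqr /kbound /g.
  have := nsq_ge0 (G1 s); have := nsq_ge0 (G2 s); nra.
(* The moments of X are bounded by M, fixed before the probability space, by
   comparison with the constant process x0. *)
have XM s : 0 <= s <= T -> (\int[P]_w (nsq (X s w))%:E <= M%:E)%E.
  move=> sT; have /andP[s0 sleT] := sT.
  apply: moment_shift_le.
    exact: (measurable_solution_at hF s0 (solution_adapted solX sT)).
  have mom0 r : 0 <= r <= T -> (\int[P]_w (nsq x0)%:E <= (nsq x0)%:E)%E.
    move=> _; rewrite integral_cst//= (_ : P [set: Omega] = 1%E) ?mule1//.
    exact: probability_setT.
  have m0 : mx_measurable (`]0, T] : set R) (fun=> 0 : 'M[R]_d) by exact: mx_measurable_cst.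
  have zero_le r : 0 < r <= T -> nsq (0 : 'M[R]_d) <= kbound r by rewrite nsq0.
  have := stability disp Omega P F W x0 b sigma (fun=> 0) (fun=> 0) G1 G2
    (fun _ _ => x0) X (nsq x0) hF hW b_lip s_lip b_gr s_gr
    m0 m0 mG1 mG2 zero_le G1_le G2_le
    (constant_volterra_solution P W T hF x0 b sigma) solX x00 mom0 s sT.
  move=> /le_trans; apply.
  rewrite /B [leRHS]EFinM; apply: lee_wpmul2l.
    by rewrite lee_fin mulr_ge0 ?(ltW C0)// addr_ge0.
  rewrite fineK; last exact: integrable_fin_num ig.
  apply: (@le_trans _ _ (\int[lebesgue_measure]_(r in `]0%R, s]) (g r)%:E)%E).
    rewrite le_eqVlt; apply/orP; left; apply/eqP.
    by apply: eq_integral => r _; rewrite !subr0.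
  apply: ge0_subset_integral => //.
  - exact/measurable_EFinP.
  - by move=> r _; rewrite lee_fin.
  - by move=> r /=; rewrite !in_itv/= => /andP[-> rs]; exact: le_trans sleT.
have := stability disp Omega P F W x0 b sigma G1 G2 hG1 hG2 X hX M hF hW
  b_lip s_lip b_gr s_gr mG1 mG2 mhG1 mhG2 G1_le hG1_kb hG2_kb solX solhX M0 XM t tT.
rewrite (_ : \int[P]_w (nsq (hX t w - X t w))%:E =
    'E_P[fun w => (frob (hX t w - X t w) ^+ 2)%R])%E; last first.
  by rewrite unlock; apply: eq_integral => w _; rewrite frob_sqr.
rewrite (_ : \int[lebesgue_measure]_(s in `]0%R, t])
    (nsq (hG1 s - G1 s) + nsq (hG2 s - G2 s))%:E =
  \int[lebesgue_measure]_(s in `]0%R, t])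
    (frob (hG1 s - G1 s) ^+ 2 + frob (hG2 s - G2 s) ^+ 2)%:E)%E//.
by apply: eq_integral => s _; rewrite !frob_sqr.
Qed.
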